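(* Let $G_1, G_2, G_3$ be (possibly empty) complete multipartite graphs such that every partite set of $G_2$ has even size and every partite set of $G_3$ has size divisible by $4$, and let $q_1,q_2,q_3\ge 0$ be integers. Let $\gamma$ be the complete multipartite graph $4G_1+2G_2+G_3+K_{q_1,q_2,q_3}$. Suppose that one of the following conditions holds: (1) two or three of the $q_i$ equal $0$; (2) two of the $q_i$ are odd and equal, and the third $q_i=0$; (3) two of the $q_i$ are odd and equal, the third $q_i\equiv 1 \pmod 4$, and $G_1=\emptyset$; (4) one $q_i\equiv 2\pmod 4$, one $q_i\equiv 1 \pmod 4$, and the third $q_i=0$; (5) two of the $q_i$ satisfy $q_i\equiv 2\pmod 4$, the third $q_i=0$, and $G_1=\emptyset$. Then $\gamma$ is achirally embeddable in $S^3$.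
   Context: A graph is achirally embeddable in $S^3$ if it has an embedding $\Gamma$ in $S^3$ for which there is an orientation-reversing homeomorphism $h$ of $S^3$ with $h(\Gamma)=\Gamma$ (equivalently, $\Gamma$ is ambient isotopic to its mirror image). The join $A+B$ of graphs $A$ and $B$ is the disjoint union $A\cup B$ together with edges joining every vertex of $A$ to every vertex of $B$; for a natural number $n$ and a graph $G$, $nG$ denotes the join of $n$ copies of $G$. In a complete multipartite graph $K_{m_1,\dots,m_n}$ the partite sets are the $n$ independent sets of vertices, and the size of a partite set is its number of vertices. A partite set of size $0$ (e.g. $q_i=0$) simply means that partite set is absent, and an empty graph contributes nothing to a join. *)

(* Defs.v *)
From HB Require Import structures.
From mathcomp Require Import all_boot all_order all_algebra.
From mathcomp Require Import all_classical all_reals all_analysis.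
Set Implicit Arguments. Unset Strict Implicit. Unset Printing Implicit Defensive.
Import Order.TTheory GRing.Theory Num.Theory.
Import numFieldNormedType.Exports.
Local Open Scope classical_set_scope.
Local Open Scope ring_scope.

Record graph := Graph { vert : finType; adj : rel vert }.

Definition empty_graph : graph := Graph (fun (_ _ : void) => false).

Definition gjoin (A B : graph) : graph :=
  @Graph (vert A + vert B)%type
    (fun x y => match x, y with
                | inl a, inl b => adj a b
                | inr a, inr b => adj a b
                | _, _ => true
                end).

Fixpoint njoin (n : nat) (G : graph) : graph :=
  match n with 0 => empty_graph | n'.+1 => gjoin G (njoin n' G) end.

Definition cmp (s : seq nat) : graph :=
  @Graph {i : 'I_(size s) & 'I_(nth 0%N s i)} (fun x y => tag x != tag y).

Section Topo.
Variable R : realType.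

Definition pt := 'rV[R]_4.

Definition S3 : set pt := [set x | \sum_(i < 4) (x ord0 i) ^+ 2 = 1].

Definition homeo_S3 (f : pt -> pt) : Prop :=
  (forall x, S3 x -> S3 (f x)) /\ {within S3, continuous f} /\
  exists g : pt -> pt, (forall x, S3 x -> S3 (g x)) /\ {within S3, continuous g} /\
    (forall x, S3 x -> g (f x) = x) /\ (forall x, S3 x -> f (g x) = x).

Definition ambient_isotopic (A B : set pt) : Prop :=
  exists H : pt -> R -> pt,
    {within S3 `*` `[0, 1], continuous (fun z : pt * R => H z.1 z.2)} /\
    (forall t, t \in `[0, 1] -> homeo_S3 (fun x => H x t)) /\
    (forall x, S3 x -> H x 0 = x) /\
    (fun x => H x 1) @` A = B.

Definition mirror (x : pt) : pt :=
  \row_(i < 4) (if i == ord0 then - x ord0 i else x ord0 i).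

(* An embedding of the (simple) graph G in S^3: vertices go to distinct points
   p v, every edge {u,v} goes to an arc a u v : [0,1] -> S^3 from p u to p v
   (a v u is the same arc reversed), the open arcs are injective, pairwise
   disjoint and avoid the vertex points.  [image] is the resulting subset of
   S^3, i.e. the image of a topological embedding of the geometric
   realization of G. *)
Definition is_embedding (G : graph) (p : vert G -> pt)
    (a : vert G -> vert G -> R -> pt) : Prop :=
  (forall v, S3 (p v)) /\ injective p /\
  (forall u v, adj u v ->
     {within `[0, 1], continuous (a u v)} /\
     a u v 0 = p u /\ a u v 1 = p v /\
     (forall t, t \in `[0, 1] -> S3 (a u v t) /\ a u v t = a v u (1 - t))) /\
  (forall u v w t, adj u v -> t \in `]0, 1[ -> a u v t <> p w) /\
  (forall u v u' v' s t, adj u v -> adj u' v' -> s \in `]0, 1[ -> t \in `]0, 1[ ->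
     a u v s = a u' v' t ->
     (u = u' /\ v = v' /\ s = t) \/ (u = v' /\ v = u' /\ s = 1 - t)).

Definition emb_image (G : graph) (p : vert G -> pt)
    (a : vert G -> vert G -> R -> pt) : set pt :=
  [set x | (exists w, x = p w) \/
           (exists u v t, adj u v /\ t \in `[0, 1] /\ x = a u v t)].

Definition achirally_embeddable (G : graph) : Prop :=
  exists p a, @is_embedding G p a /\
    ambient_isotopic (emb_image p a) (mirror @` emb_image p a).
End Topo.

(* ordered-triple version; [G1empty] says G_1 is the empty graph *)
Local Open Scope nat_scope.
Local Open Scope nat_scope.
Definition q_condition (G1empty : bool) (a b c : nat) : Prop :=
  (b = 0 /\ c = 0) \/
  (odd a /\ a = b /\ c = 0) \/
  (odd a /\ a = b /\ c %% 4 = 1 /\ G1empty) \/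
  (a %% 4 = 2 /\ b %% 4 = 1 /\ c = 0) \/
  (a %% 4 = 2 /\ b %% 4 = 2 /\ c = 0 /\ G1empty).

(* Main.v *)
(* The automorphism used on the graph has order 4: it permutes the four copies
   of G_1 cyclically, exchanges the two copies of G_2, and preserves the parts of
   G_3. All its orbits have length 4 except those of at most four leftover
   vertices of K_{q1,q2,q3}. It is realized by the orientation reversing isometry
   h(x0, x1, x2, x3) = (x0, -x1, -x3, x2) of S^3, for which mirror o h is a
   rotation, so that an h-invariant image is isotopic to its mirror image. The
   leftover vertices lie on the circle x2 = x3 = 0 fixed pointwise by h^2; a
   vertex z of a long orbit, z being a unit complex number, is placed in the
   direction (1, Re (z^2), Re z, Im z), and h acts on these directions as
   multiplication of z by i. All edges are radial projections of straight
   segments. Four directions z1, ..., z4 as above are independent unless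
   z1 z2 z3 z4 = 1, which never happens if each z is a power of i times a number
   of small positive argument. The edges joining z to -z cross the fixed circle,
   whence the restriction on G_1 when the leftover vertices and edges fill it. *)

Require Import Defs.
From HB Require Import structures.
From mathcomp Require Import all_boot all_order all_algebra.
From mathcomp Require Import all_classical all_reals all_analysis.
From mathcomp Require Import complex ring lra zify.
Set Implicit Arguments. Unset Strict Implicit. Unset Printing Implicit Defensive.
Import Order.TTheory GRing.Theory Num.Theory.
Import numFieldNormedType.Exports.
Local Open Scope ring_scope.
Local Open Scope complex_scope.

(** * Directions of the vertices in long orbits *)
Section Positions.
Variable R : realType.
Implicit Types (x y z w : R[i]).

Local Notation Re := (@complex.Re R).
Local Notation Im := (@complex.Im R).

Definition free_pos : Type := (nat * (bool * bool))%type.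

(** The two bits are the binary digits, low digit first, of an exponent of i; the exponent grows by
    1 modulo 4. *)
Definition quarter_turn (a : free_pos) : free_pos :=
  (a.1, (~~ a.2.1, a.2.1 (+) a.2.2)).

Definition antipode (a : free_pos) : free_pos := (a.1, (a.2.1, ~~ a.2.2)).

(** Half-angle tangents make the coordinates of [omega] rational expressions; the shift by 20 keeps
    the angles so small that any four add up to less than a right angle. *)
Definition slope (n : nat) : R := (n + 20)%:R^-1.

(* The point of the unit circle whose half-angle has tangent [slope n]. *)
Definition omega (n : nat) : R[i] :=
  locked (((1 - slope n ^+ 2) / (1 + slope n ^+ 2)) +i* (2 * slope n / (1 + slope n ^+ 2))).

Definition dir (a : free_pos) : R[i] := (-1) ^+ a.2.2 * 'i%C ^+ a.2.1 * omega a.1.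

Lemma slope_bounds n : 0 < slope n <= 1 / 20.
Proof.
rewrite /slope invr_gt0 ltr0n addn_gt0 orbT /= div1r lef_pV2 ?posrE ?ltr0n ?addn_gt0 ?orbT//.
by rewrite ler_nat leq_addl.
Qed.

Lemma omega_bounds n :
  [/\ Re (omega n) ^+ 2 + Im (omega n) ^+ 2 = 1, 99 / 100 <= Re (omega n) <= 1
    & 0 < Im (omega n) <= 1 / 10].
Proof.
have /andP[t0 t1] := slope_bounds n; rewrite /omega -!lock /=; move: (slope n) t0 t1 => t t0 t1.
have d0 : 0 < 1 + t ^+ 2 by nra.
split; first by field; rewrite gt_eqF.
- by rewrite ler_pdivlMr // ler_pdivrMr //; apply/andP; split; nra.
- by rewrite ltr_pdivlMr // ler_pdivrMr //; apply/andP; split; nra.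
Qed.

Lemma omega_inj : injective omega.
Proof.
have tE n : slope n = Im (omega n) / (1 + Re (omega n)).
  have /andP[t0 _] := slope_bounds n; rewrite /omega -!lock /=.
  have d0 : 0 < 1 + slope n ^+ 2 by nra.
  by field; rewrite gt_eqF //=; apply/eqP; lra.
move=> m n e; have := tE m; rewrite e -tE => /invr_inj/eqP.
by rewrite eqr_nat eqn_add2r => /eqP.
Qed.

Lemma dirE a : dir a = match a.2 with
  | (false, false) => Re (omega a.1) +i* Im (omega a.1)
  | (true, false) => - Im (omega a.1) +i* Re (omega a.1)
  | (false, true) => - Re (omega a.1) +i* - Im (omega a.1)
  | (true, true) => Im (omega a.1) +i* - Re (omega a.1) end.
Proof.
rewrite /dir; case: a => n [b0 b1] /=; move: (omega n) => [c s].
case: b0; case: b1; rewrite /= ?expr0 ?expr1 ?mul1r ?mulr1 ?mulN1r //;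
  by apply/eqP; rewrite eq_complex /=; apply/andP; split; apply/eqP; ring.
Qed.

Lemma dir_quarter_turn a : dir (quarter_turn a) = 'i%C * dir a.
Proof.
rewrite !dirE; case: a => n [b0 b1] /=; case: b0; case: b1;
  by apply/eqP; rewrite eq_complex /=; apply/andP; split; apply/eqP; ring.
Qed.

Lemma dir_antipode a : dir (antipode a) = - dir a.
Proof.
rewrite !dirE; case: a => n [b0 b1] /=; case: b0; case: b1;
  by apply/eqP; rewrite eq_complex /=; apply/andP; split; apply/eqP; ring.
Qed.

Lemma dir_unit a : dir a * conjc (dir a) = 1.
Proof.
rewrite dirE; case: a => n [b0 b1]; have [e _ _] := omega_bounds n.
case: b0; case: b1; apply/eqP; rewrite eq_complex /=; apply/andP; split; apply/eqP; nra.
Qed.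

Lemma dir_inj : injective dir.
Proof.
move=> [m [a0 a1]] [n [b0 b1]]; rewrite !dirE /=.
have [_ /andP[cm _] /andP[sm _]] := omega_bounds m.
have [_ /andP[cn _] /andP[sn _]] := omega_bounds n.
have H c s c' s' : Re (omega m) = c -> Im (omega m) = s ->
    Re (omega n) = c' -> Im (omega n) = s' -> c = c' -> s = s' -> m = n.
  move=> <- <- <- <- e1 e2; apply: omega_inj.
  by move: e1 e2; case: (omega m) => ? ?; case: (omega n) => ? ? /= -> ->.
by move=> e; case: a0 a1 b0 b1 e => [] [] [] [] [] e1 e2;
  (exfalso; lra) || congr (_, _); apply: (H _ _ _ _ erefl erefl erefl erefl); lra.
Qed.

(** The product is a power of i times the product [W] of four values of [omega]. Since [W] lies in
    the open first quadrant, no power of i takes it to 1. *)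
Lemma dir_mul4_neq1 a b c d : dir a * (dir b * dir c * dir d) <> 1.
Proof.
have i4 n : Re ('i%C ^+ n : R[i]) * Im ('i%C ^+ n : R[i]) = 0.
  elim: n => [|n IH]; first by rewrite expr0 /= mulr0.
  by rewrite exprS; move: IH; case: ('i%C ^+ n) => p q /=; nra.
have [e1 /andP[c1 _] /andP[s1 s1']] := omega_bounds a.1.
have [e2 /andP[c2 _] /andP[s2 s2']] := omega_bounds b.1.
have [e3 /andP[c3 _] /andP[s3 s3']] := omega_bounds c.1.
have [e4 /andP[c4 _] /andP[s4 s4']] := omega_bounds d.1.
set W := (omega a.1 * omega b.1) * (omega c.1 * omega d.1).
have prod_bounds x y : 9 / 10 <= Re x -> 9 / 10 <= Re y -> 0 < Im x <= 1 / 4 ->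
    0 < Im y <= 1 / 4 -> 0 < Re (x * y) /\ 0 < Im (x * y).
  case: x => p q; case: y => p' q' /= h1 h2 /andP[h3 h4] /andP[h5 h6].
  by split; nra.
have two x y : 99 / 100 <= Re x -> 99 / 100 <= Re y -> Re x <= 1 -> Re y <= 1 ->
    0 < Im x <= 1 / 10 ->
    0 < Im y <= 1 / 10 -> 9 / 10 <= Re (x * y) /\ 0 < Im (x * y) <= 1 / 4.
  case: x => p q; case: y => p' q' /= h1 h2 g1 g2 /andP[h3 h4] /andP[h5 h6].
  have u1 : 0 <= (1 - p) * q' by nra.
  have u2 : 0 <= (1 - p') * q by nra.
  by split; [nra | apply/andP; split; nra].
have [W1 W2] : 0 < Re W /\ 0 < Im W.
  have [r1 i1] : 9 / 10 <= Re (omega a.1 * omega b.1) /\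
      0 < Im (omega a.1 * omega b.1) <= 1 / 4.
    by apply: two => //; rewrite ?s1 ?s2 //; nra.
  have [r2 i2] : 9 / 10 <= Re (omega c.1 * omega d.1) /\
      0 < Im (omega c.1 * omega d.1) <= 1 / 4.
    by apply: two => //; rewrite ?s3 ?s4 //; nra.
  exact: prod_bounds.
have m1 : (-1 : R[i]) = 'i%C ^+ 2 by rewrite sqr_i.
set N := (2 * a.2.2 + a.2.1 + (2 * b.2.2 + b.2.1) + (2 * c.2.2 + c.2.1)
  + (2 * d.2.2 + d.2.1))%N.
have -> : dir a * (dir b * dir c * dir d) = 'i%C ^+ N * W.
  by rewrite /dir m1 -!exprM /W /N !exprD; ring.
have := i4 N; case: ('i%C ^+ N) => p q; case: W W1 W2 => C S /= W1 W2 pq e.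
have eR : p * C - q * S = 1 by move: e => [] ->.
have eI : p * S + q * C = 0 by move: e => [].
have [p0|q0] : p = 0 \/ q = 0 by move/eqP: pq; rewrite mulf_eq0 => /orP[]/eqP; [left|right].
- by subst p; nra.
- by subst q; nra.
Qed.

(** The product of two directions is a power of i times a number close to 1. The first bits decide
    whether it is close to the real or to the imaginary axis; in the former case all bits together
    give the sign. *)
Lemma dir_pair_bound a b (r := Re (dir a * dir b)) :
  if a.2.1 == b.2.1 then
    19 / 20 <= (if a.2.1 (+) a.2.2 (+) b.2.2 then - r else r) <= 1
  else - (1 / 5) <= r <= 1 / 5.
Proof.
rewrite {}/r !dirE; case: a => m [a0 a1]; case: b => n [b0 b1] /=.
have [_ /andP[p1 p1'] /andP[s1 s1']] := omega_bounds m.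
have [_ /andP[p2 p2'] /andP[s2 s2']] := omega_bounds n.
move: (Re _) (Im _) (Re _) (Im _) p1 p1' s1 s1' p2 p2' s2 s2'.
move=> x y x' y' p1 p1' s1 s1' p2 p2' s2 s2'.
have : 98 / 100 <= x * x' <= 1 by apply/andP; split; nra.
have : 0 <= y * y' <= 1 / 100 by apply/andP; split; nra.
have : 0 <= x * y' <= 1 / 10 by apply/andP; split; nra.
have : 0 <= y * x' <= 1 / 10 by apply/andP; split; nra.
clear p1 p1' s1 s1' p2 p2' s2 s2'.
by move=> /andP[? ?] /andP[? ?] /andP[? ?] /andP[? ?];
  case: a0 a1 b0 b1 => [] [] [] [] /=; apply/andP; split; lra.
Qed.

(** If the three first bits agree, the sum of three terms close to 1 or -1 is close to an odd
    integer. Otherwise one term is close to 1 or -1 and the other two are at most 1/5 in absolute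
    value. This keeps [plane_form] from vanishing at axis positions. *)
Lemma dir_pairs_bound a b c :
  1 / 2 < `|Re (dir a * dir b) + Re (dir a * dir c) + Re (dir b * dir c)|.
Proof.
rewrite ltNge ler_norml; apply/negP => /andP[].
have := dir_pair_bound a b; have := dir_pair_bound a c; have := dir_pair_bound b c.
move: (Re _) (Re _) (Re _) => r23 r13 r12.
by case: a b c => [? [[] []]] [? [[] []]] [? [[] []]] /= /andP[? ?] /andP[? ?] /andP[? ?];
  lra.
Qed.

(** The edge from z to -z meets the fixed circle in direction (1, Re (z^2)), which therefore lies
    outside the sector between (1, 1/2) and (1, -1/2). *)
Lemma dir_square_bound a : 1 / 2 < `|Re (dir a ^+ 2)|.
Proof.
have [_ /andP[p p'] /andP[s s']] := omega_bounds a.1.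
rewrite ltNge ler_norml dirE expr2; apply/negP => /andP[].
by case: a.2 => [[] []] /= k1 k2; nra.
Qed.
End Positions.

(** * Linear relations between the directions *)
Section Independence.
Variable R : realType.

Local Notation Re := (@complex.Re R).
Local Notation Im := (@complex.Im R).
Local Notation dir := (@dir R).

Definition axis_pos : Type := (bool * bool)%type.
Definition position : Type := (free_pos + axis_pos)%type.

(* Encodes (1, 1/2), (1, -1/2), (1, 0) and (-1, 0) in the plane fixed by h^2; the
   first bit tells the points fixed by h from the two exchanged by it. *)
Definition axA : axis_pos := (false, true).
Definition axB : axis_pos := (false, false).
Definition axO : axis_pos := (true, true).
Definition axN : axis_pos := (true, false).

Definition axis_fst (c : axis_pos) : R := if c.1 && ~~ c.2 then -1 else 1.
Definition axis_snd (c : axis_pos) : R :=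
  if c.1 then 0 else if c.2 then 1 / 2 else - (1 / 2).

Definition coords (p : position) : seq R :=
  match p with
  | inl a => [:: 1; Re (dir a ^+ 2); Re (dir a); Im (dir a)]
  | inr c => [:: axis_fst c; axis_snd c; 0; 0]
  end.

Definition relation4 (l1 : R) p1 l2 p2 l3 p3 l4 p4 : Prop :=
  forall k, (k < 4)%N -> l1 * (coords p1)`_k + l2 * (coords p2)`_k +
    l3 * (coords p3)`_k + l4 * (coords p4)`_k = 0.

(* On a free position this is z^-2 times the quartic with roots y1, y2, y3 and
   (y1 y2 y3)^-1; the choice of the fourth root makes the two extreme
   coefficients equal, so that the form only involves Re (z^2), z and 1. *)
Definition plane_form (y1 y2 y3 : R[i]) (s : seq R) : R[i] :=
  let y4 := conjc (y1 * y2 * y3) in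
  2 * (s`_1)%:C
  + 2 * (Re (y1 * y2) + Re (y1 * y3) + Re (y2 * y3))%:C * (s`_0)%:C
  - (y1 + y2 + y3 + y4) * ((s`_2)%:C + 'i%C * (s`_3)%:C)
  - (y1 * y2 * y3 + y4 * (y1 * y2 + y1 * y3 + y2 * y3)) *
    ((s`_2)%:C - 'i%C * (s`_3)%:C).

Lemma relation4_plane_form l1 p1 l2 p2 l3 p3 l4 p4 y1 y2 y3 :
  relation4 l1 p1 l2 p2 l3 p3 l4 p4 ->
  l1%:C * plane_form y1 y2 y3 (coords p1) + l2%:C * plane_form y1 y2 y3 (coords p2)
  + l3%:C * plane_form y1 y2 y3 (coords p3)
  + l4%:C * plane_form y1 y2 y3 (coords p4) = 0.
Proof.
move=> rel; have r0 := rel 0%N isT; have r1 := rel 1%N isT.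
have r2 := rel 2%N isT; have r3 := rel 3%N isT.
have lin (a b c d a' b' c' d' : R) :
    a * a' + b * b' + c * c' + d * d' = 0 ->
    a%:C * a'%:C + b%:C * b'%:C + c%:C * c'%:C + d%:C * d'%:C = 0 :> R[i].
  by move=> e; rewrite -!rmorphM -!rmorphD e rmorph0.
move: {rel r0 r1 r2 r3} (lin _ _ _ _ _ _ _ _ r0) (lin _ _ _ _ _ _ _ _ r1)
  (lin _ _ _ _ _ _ _ _ r2) (lin _ _ _ _ _ _ _ _ r3).
rewrite /plane_form.
move: (coords p1) (coords p2) (coords p3) (coords p4) => s t u v.
set A := 2 * (_ + _ + _)%:C; set B := _ + conjc _; set C := _ + conjc _ * _ => r0 r1 r2 r3.
set S := (X in X = 0).
have -> : S = A * (l1%:C * (s`_0)%:C + l2%:C * (t`_0)%:C + l3%:C * (u`_0)%:C + l4%:C * (v`_0)%:C)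
  + 2 * (l1%:C * (s`_1)%:C + l2%:C * (t`_1)%:C + l3%:C * (u`_1)%:C + l4%:C * (v`_1)%:C)
  - (B + C) * (l1%:C * (s`_2)%:C + l2%:C * (t`_2)%:C + l3%:C * (u`_2)%:C + l4%:C * (v`_2)%:C)
  - (B - C) * 'i%C * (l1%:C * (s`_3)%:C + l2%:C * (t`_3)%:C + l3%:C * (u`_3)%:C + l4%:C * (v`_3)%:C).
  by rewrite /S; ring.
by rewrite r0 r1 r2 r3 !mulr0 !subr0 addr0.
Qed.

Lemma plane_form_free a b c d :
  plane_form (dir a) (dir b) (dir c) (coords (inl d)) =
  conjc (dir d) ^+ 2 * ((dir d - dir a) * (dir d - dir b) * (dir d - dir c) *
    (dir d - conjc (dir a * dir b * dir c))).
Proof.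
have tw (x : R[i]) : 2 * (Re x)%:C = x + conjc x by rewrite addcJ.
rewrite /plane_form /= -(complexE (dir d)).
have -> : (Re (dir d))%:C - 'i%C * (Im (dir d))%:C = conjc (dir d).
  by case: (dir d) => x y; apply/eqP; rewrite eq_complex /=;
    apply/andP; split; apply/eqP; ring.
move: (dir_unit R a) (dir_unit R b) (dir_unit R c) (dir_unit R d).
move: (dir a) (dir b) (dir c) (dir d) => y1 y2 y3 z ua ub uc ud.
rewrite !rmorphD [2 * (_ + _)]mulrDr [2 * (_ + _)]mulrDr !tw expr2 !rmorphM /= mulr1.
move: ua ub uc ud.
move: (conjc y1) (conjc y2) (conjc y3) (conjc z) => x1 x2 x3 w ua ub uc ud.
(* The factors [z * w] and [y1 * x1], [y2 * x2], [y3 * x3], all equal to 1, are inserted so that the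
   factored side becomes a polynomial identity. *)
transitivity ((z * w) ^+ 2 * z ^+ 2 - (z * w) ^+ 2 * (y1 + y2 + y3 + x1 * x2 * x3) * z
  + (z * w) ^+ 2 * (y1 * y2 + y1 * y3 + y2 * y3 + (y1 * x1) * (x2 * x3)
    + (y2 * x2) * (x1 * x3) + (y3 * x3) * (x1 * x2))
  - (z * w) * w * (y1 * y2 * y3 + x1 * x2 * x3 * (y1 * y2 + y1 * y3 + y2 * y3))
  + w ^+ 2 * ((y1 * x1) * (y2 * x2) * (y3 * x3))); last by ring.
rewrite ua ub uc ud; ring.
Qed.

(** Here the form is 2 ([axis_snd] + r [axis_fst]) with |r| > 1/2, whereas |[axis_snd]| is at most
    1/2 and |[axis_fst]| is 1. *)
Lemma plane_form_axis a b c d :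
  plane_form (dir a) (dir b) (dir c) (coords (inr d)) <> 0.
Proof.
rewrite /plane_form /= rmorph0 !(mulr0, subr0, addr0).
have := dir_pairs_bound R a b c; move: (_ + _ + _) => r.
rewrite -(rmorph_nat (real_complex R)) -!rmorphM -rmorphD => r2 /eqP.
rewrite fmorph_eq0 => /eqP; move: r2; rewrite ltNge ler_norml => /negP h e; apply: h.
by move: e; case: d => [[] []]; rewrite /axis_fst /axis_snd /= => e; apply/andP; split; lra.
Qed.

Lemma quarter_turn_neq a : quarter_turn a <> a.
Proof. by case: a => n [[] []]. Qed.

Lemma relation4_free_fst l1 a1 l2 a2 l3 a3 l4 a4 :
  relation4 l1 (inl a1) l2 (inl a2) l3 (inl a3) l4 (inl a4) ->
  l1 + l2 * (a2 == a1)%:R + l3 * (a3 == a1)%:R + l4 * (a4 == a1)%:R = 0.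
Proof.
(* Roots at the positions other than a1, moved away when they coincide with a1. *)
pose y a := dir (if a == a1 then quarter_turn a1 else a).
move=> /(@relation4_plane_form _ _ _ _ _ _ _ _ (y a2) (y a3) (y a4)).
set K := plane_form _ _ _ (coords (inl a1)).
have K0 : K != 0.
  apply/eqP; rewrite /K /y plane_form_free => /eqP.
  rewrite !mulf_eq0 orbb !subr_eq0 !(inj_eq (@dir_inj R)) conjc_eq0.
  have ya a : (a1 == (if a == a1 then quarter_turn a1 else a)) = false.
    case: (eqVneq a a1) => [_|na]; apply/eqP; last by move=> e; rewrite e eqxx in na.
    by move/esym/quarter_turn_neq.
  rewrite !ya !orFb => /orP[/eqP z0|/eqP e].
    by have := dir_unit R a1; rewrite z0 mul0r => /esym/eqP; rewrite oner_eq0.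
  (* If [dir a1] were the fourth root, four directions would have product 1. *)
  have := dir_unit R a1; rewrite {2}e conjcK; exact: dir_mul4_neq1.
have KE a : a = a2 \/ a = a3 \/ a = a4 ->
    plane_form (y a2) (y a3) (y a4) (coords (inl a)) = K * ((a == a1)%:R : R)%:C.
  rewrite rmorph_nat; case: (eqVneq a a1) => [-> _|na]; first by rewrite mulr1.
  move=> ea; rewrite mulr0 /y plane_form_free.
  by case: ea na => [->|[->|->]] /negbTE->; rewrite subrr !(mulr0, mul0r).
rewrite !KE; [|tauto..]; move=> e; apply/eqP.
have : K * (l1 + l2 * (a2 == a1)%:R + l3 * (a3 == a1)%:R + l4 * (a4 == a1)%:R)%:C = 0.
  by rewrite -[RHS]e !rmorphD !rmorphM /=; ring.
by move/eqP; rewrite mulf_eq0 (negbTE K0) fmorph_eq0.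
Qed.

(** A position [x] occurring among the four is moved to the front; otherwise every term is zero.
    Because positions may coincide, this is the form that linear independence takes here. *)
Lemma relation4_free l1 a1 l2 a2 l3 a3 l4 a4 x :
  relation4 l1 (inl a1) l2 (inl a2) l3 (inl a3) l4 (inl a4) ->
  l1 * (a1 == x)%:R + l2 * (a2 == x)%:R + l3 * (a3 == x)%:R + l4 * (a4 == x)%:R = 0.
Proof.
move=> rel.
case: (eqVneq a1 x) => [e1|n1].
  by have := relation4_free_fst rel; rewrite e1 /= => e; lra.
case: (eqVneq a2 x) => [e2|n2].
  have /relation4_free_fst : relation4 l2 (inl a2) l1 (inl a1) l3 (inl a3) l4 (inl a4).
    by move=> k /rel; lra.
  by rewrite e2 (negbTE n1) /= => e; lra.
case: (eqVneq a3 x) => [e3|n3].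
  have /relation4_free_fst : relation4 l3 (inl a3) l1 (inl a1) l2 (inl a2) l4 (inl a4).
    by move=> k /rel; lra.
  by rewrite e3 (negbTE n1) (negbTE n2) /= => e; lra.
case: (eqVneq a4 x) => [e4|n4]; last by rewrite !mulr0 !addr0.
have /relation4_free_fst : relation4 l4 (inl a4) l1 (inl a1) l2 (inl a2) l3 (inl a3).
  by move=> k /rel; lra.
by rewrite e4 (negbTE n1) (negbTE n2) (negbTE n3) /= => e; lra.
Qed.

(** With the roots of the form at the three free positions, only the axis term survives, and the
    form is nonzero there. *)
Lemma relation4_axis l1 c l2 a2 l3 a3 l4 a4 :
  relation4 l1 (inr c) l2 (inl a2) l3 (inl a3) l4 (inl a4) -> l1 = 0.
Proof.
move=> /(@relation4_plane_form _ _ _ _ _ _ _ _ (dir a2) (dir a3) (dir a4)).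
rewrite !plane_form_free !subrr !(mulr0, mul0r, addr0) => /eqP.
by rewrite mulf_eq0 fmorph_eq0 => /orP[/eqP //|/eqP/plane_form_axis].
Qed.
End Independence.

(** * Disjointness of the cells *)
Section Cells.
Variable R : realType.

Local Notation Re := (@complex.Re R).
Local Notation Im := (@complex.Im R).
Local Notation dir := (@dir R).
Local Notation coords := (@coords R).

(** The cells that would collide on the fixed circle are excluded. O and N are antipodal, so their
    segment contains the origin. The edge from A to B runs through O. An edge from z to -z crosses
    the circle beyond A or beyond B, where edges ending at N run. *)
Record admissible (S : position -> position -> Prop) : Prop := Admissible {
  cell_sym : forall p q, S p q -> S q p;
  cell_refl : forall p q, S p q -> S p p;
  cell_ON : ~ S (inr axO) (inr axN);
  cell_ABO : ~ S (inr axA) (inr axB) \/ ~ S (inr axO) (inr axO);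
  cell_antipodal_N :
    (forall a, ~ S (inl a) (inl (antipode a))) \/ ~ S (inr axN) (inr axN) }.

Definition balance (a : R) p (b : R) q (c : R) p' (d : R) q' : Prop :=
  forall k, (k < 4)%N ->
    a * (coords p)`_k + b * (coords q)`_k = c * (coords p')`_k + d * (coords q')`_k.

(** Equality of formal combinations of positions: the weights of coinciding positions add up. *)
Definition same_weights (a : R) (p : position) (b : R) (q : position)
    (c : R) (p' : position) (d : R) (q' : position) : Prop :=
  forall x, a * (p == x)%:R + b * (q == x)%:R = c * (p' == x)%:R + d * (q' == x)%:R.

(** Nonnegative combinations of two positions fill the cone over an edge, or over a vertex when the
    two coincide. In the lemma names below, [a] and [f] mark each of the four positions as axis or
    free. *)
Definition cells_disjoint S p q p' q' : Prop := forall a b c d,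
  admissible S -> S p q -> S p' q' -> 0 <= a -> 0 <= b -> 0 <= c -> 0 <= d ->
  balance a p b q c p' d q' -> same_weights a p b q c p' d q'.

Lemma cells_disjoint_swapl S p q p' q' :
  cells_disjoint S q p p' q' -> cells_disjoint S p q p' q'.
Proof.
move=> H a b c d adm s s' a0 b0 c0 d0 bal x; rewrite addrC.
apply: H => //; first exact: (cell_sym adm).
by move=> k k4; rewrite addrC; exact: bal.
Qed.

Lemma cells_disjoint_swap S p q p' q' :
  cells_disjoint S p' q' p q -> cells_disjoint S p q p' q'.
Proof.
by move=> H a b c d adm s s' a0 b0 c0 d0 bal x; apply/esym/H => // k k4; rewrite bal.
Qed.

Lemma cells_disjoint_swapr S p q p' q' :
  cells_disjoint S p q q' p' -> cells_disjoint S p q p' q'.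
Proof.
by move=> /cells_disjoint_swap/cells_disjoint_swapl/cells_disjoint_swap.
Qed.

Lemma cells_disjoint_ffff S p q p' q' :
  cells_disjoint S (inl p) (inl q) (inl p') (inl q').
Proof.
move=> a b c d _ _ _ _ _ _ _ bal [] x; last by rewrite !mulr0.
have /(relation4_free x) : relation4 a (inl p) b (inl q) (- c) (inl p') (- d) (inl q').
  by move=> k /bal; lra.
by rewrite !(inj_eq inl_inj); lra.
Qed.

Lemma cells_disjoint_afff S p q p' q' :
  cells_disjoint S (inr p) (inl q) (inl p') (inl q').
Proof.
move=> a b c d _ _ _ _ _ _ _ bal x.
have /relation4_axis a0 : relation4 a (inr p) b (inl q) (- c) (inl p') (- d) (inl q').
  by move=> k /bal; lra.
rewrite {}a0 in bal *.
case: x => x; last by rewrite !mulr0 mul0r.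
have /(relation4_free x) : relation4 0 (inl q) b (inl q) (- c) (inl p') (- d) (inl q').
  by move=> k /bal; rewrite !mul0r; lra.
by rewrite !(inj_eq inl_inj) !mul0r; lra.
Qed.

Definition axis_weight (a : R) (p : axis_pos) (b : R) (q x : axis_pos) : R :=
  a * (p == x)%:R + b * (q == x)%:R.

Lemma axis_weight_fst a p b q : a * axis_fst R p + b * axis_fst R q =
  axis_weight a p b q axA + axis_weight a p b q axB + axis_weight a p b q axO
  - axis_weight a p b q axN.
Proof.
by rewrite /axis_weight /axis_fst; case: p q => [[] []] [[] []] /=; ring.
Qed.

Lemma axis_weight_snd a p b q : a * axis_snd R p + b * axis_snd R q =
  1 / 2 * (axis_weight a p b q axA - axis_weight a p b q axB).
Proof.
by rewrite /axis_weight /axis_snd; case: p q => [[] []] [[] []] /=; field.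
Qed.

Lemma axis_weight_cell S a p b q : admissible S -> S (inr p) (inr q) ->
  let w := axis_weight a p b q in w axO * w axN = 0 /\ w axA * w axB * w axN = 0.
Proof.
move=> adm s /=; rewrite /axis_weight; split.
- move: s; case: p q => [[] []] [[] []] s /=; try ring.
  + by case: (cell_ON adm).
  + by case: (cell_ON adm); apply: (cell_sym adm).
- by case: p q {s} => [[] []] [[] []] /=; ring.
Qed.

Lemma axis_weight_ABO S : admissible S ->
  (forall a p b q, S (inr p) (inr q) ->
     axis_weight a p b q axA * axis_weight a p b q axB = 0) \/
  (forall a p b q, S (inr p) (inr q) -> axis_weight a p b q axO = 0).
Proof.
move=> adm; have [nAB|nO] := cell_ABO adm; [left|right] => a p b q; rewrite /axis_weight;
  case: p q => [[] []] [[] []] s /=; try ring.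
- by case: nAB.
- by case: nAB; apply: (cell_sym adm).
all: case: nO; solve [exact: s | exact: (cell_refl adm s)
  | exact: (cell_refl adm (cell_sym adm s))].
Qed.

(** If A and B never occur together, their weights are the positive and negative parts of the second
    coordinate. If O is absent, the rays A, B and N form a fan, whose cones do not overlap. The
    weights of O and N are then the positive and negative parts of what remains of the first
    coordinate. *)
Lemma planar_weights_eq (A B O N A' B' O' N' : R) :
  0 <= A -> 0 <= B -> 0 <= O -> 0 <= N -> 0 <= A' -> 0 <= B' -> 0 <= O' -> 0 <= N' ->
  A + B + O - N = A' + B' + O' - N' -> A - B = A' - B' ->
  O * N = 0 -> O' * N' = 0 -> A * B * N = 0 -> A' * B' * N' = 0 ->
  (A * B = 0 /\ A' * B' = 0) \/ (O = 0 /\ O' = 0) ->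
  [/\ A = A', B = B', O = O' & N = N'].
Proof.
have split2 (x y : R) : x * y = 0 -> x = 0 \/ y = 0.
  by move/eqP; rewrite mulf_eq0 => /orP[]/eqP; tauto.
move=> A0 B0 O0 N0 A0' B0' O0' N0' e1 e2 /split2 ON /split2 ON' ABN ABN' AB.
have [eA eB] : A = A' /\ B = B'.
  case: AB => [[/split2 AB /split2 AB']|[zO zO']].
    by case: AB AB' => [] ? [] ?; split; lra.
  have {ABN} : (A = 0 \/ B = 0) \/ N = 0 by move/split2: ABN => [/split2|]; tauto.
  have {ABN'} : (A' = 0 \/ B' = 0) \/ N' = 0 by move/split2: ABN' => [/split2|]; tauto.
  by clear ON ON'; case=> [[]|] ? [[]|] ?; split; lra.
by case: ON ON' => [] ? [] ?; split; lra.
Qed.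

Lemma cells_disjoint_aaaa S p q p' q' :
  cells_disjoint S (inr p) (inr q) (inr p') (inr q').
Proof.
move=> a b c d adm s s' a0 b0 c0 d0 bal.
have e1 := bal 0%N isT; have e2 := bal 1%N isT.
rewrite /= !axis_weight_fst in e1; rewrite /= !axis_weight_snd in e2.
have [ON ABN] := axis_weight_cell a b adm s.
have [ON' ABN'] := axis_weight_cell c d adm s'.
have AB : let w := axis_weight a p b q in let w' := axis_weight c p' d q' in
    (w axA * w axB = 0 /\ w' axA * w' axB = 0) \/ (w axO = 0 /\ w' axO = 0).
  by have [H|H] := axis_weight_ABO adm; [left|right]; split; apply: H.
have ge0 u x v y z : 0 <= u -> 0 <= v -> 0 <= axis_weight u x v y z.
  by move=> u0 v0; rewrite /axis_weight addr_ge0 // mulr_ge0.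
case=> x; first by rewrite !mulr0.
rewrite !(inj_eq inr_inj) -!/(axis_weight _ _ _ _ x).
have [eA eB eO eN] := planar_weights_eq (ge0 _ p _ q axA a0 b0) (ge0 _ p _ q axB a0 b0)
  (ge0 _ p _ q axO a0 b0) (ge0 _ p _ q axN a0 b0) (ge0 _ p' _ q' axA c0 d0)
  (ge0 _ p' _ q' axB c0 d0) (ge0 _ p' _ q' axO c0 d0) (ge0 _ p' _ q' axN c0 d0)
  e1 ltac:(lra) ON ON' ABN ABN' AB.
by case: x => [[] []].
Qed.

Lemma dir_balance (b d : R) p q : 0 <= b -> 0 <= d ->
  b * Re (dir p) = d * Re (dir q) -> b * Im (dir p) = d * Im (dir q) ->
  b = d /\ (b = 0 \/ p = q).
Proof.
move=> b0 d0 e1 e2.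
have sq r : Re (dir r) ^+ 2 + Im (dir r) ^+ 2 = 1.
  have := dir_unit R r; case: (dir r) => x y /= /eqP.
  by rewrite eq_complex /= => /andP[/eqP e _]; rewrite !expr2; lra.
have bd : b = d.
  apply/eqP; rewrite -(eqrXn2 (n := 2)) //; apply/eqP.
  rewrite -[b ^+ 2]mulr1 -[d ^+ 2]mulr1 -{1}(sq p) -(sq q) !mulrDr -!exprMn.
  by rewrite e1 e2.
split=> //; have [->|bn0] := eqVneq b 0; [by left|right].
apply: (@dir_inj R); rewrite -bd in e1 e2.
move: (mulfI bn0 e1) (mulfI bn0 e2).
by case: (dir p) (dir q) => ? ? [? ?] /= -> ->.
Qed.

Lemma cells_disjoint_aaaf S p q p' q' :
  cells_disjoint S (inr p) (inr q) (inr p') (inl q').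
Proof.
move=> a b c d adm s s' a0 b0 c0 d0 bal.
(* The three axis vectors have vanishing last two coordinates, so the single free term must
   vanish. *)
have d0' : d = 0.
  have := bal 2%N isT; have := bal 3%N isT; rewrite /= !mulr0 !addr0 !add0r => e2 e1.
  have [] : 0 = d /\ (0 = 0 :> R \/ q' = q') by apply: dir_balance => //; rewrite mul0r.
  by [].
rewrite {}d0' in bal *.
have S' := cell_refl adm s'.
have := @cells_disjoint_aaaa S p q p' p' a b c 0 adm s S' a0 b0 c0 (lexx 0).
have bal' : balance a (inr p) b (inr q) c (inr p') 0 (inr p').
  by move=> k k4; rewrite bal // !mul0r.
by move=> /(_ bal') sw x; rewrite sw !mul0r.
Qed.

(** The last two coordinates force the free terms to be equal; cancelling them leaves a relation
    between axis positions. *)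
Lemma cells_disjoint_afaf S p q p' q' :
  cells_disjoint S (inr p) (inl q) (inr p') (inl q').
Proof.
move=> a b c d adm s s' a0 b0 c0 d0 bal.
have [bd bq] : b = d /\ (b = 0 \/ q = q').
  by apply: dir_balance => //; [have := bal 2%N isT | have := bal 3%N isT];
    rewrite /= !mulr0 !add0r.
have e k : b * (coords (inl q))`_k = d * (coords (inl q'))`_k.
  by rewrite -bd; case: bq => ->; rewrite ?mul0r.
have := @cells_disjoint_aaaa S p p p' p' a 0 c 0 adm (cell_refl adm s)
  (cell_refl adm s') a0 (lexx 0) c0 (lexx 0).
have bal' : balance a (inr p) 0 (inr p) c (inr p') 0 (inr p').
  by move=> k k4; have := bal k k4; have := e k; lra.
move=> /(_ bal') sw x; have := sw x; rewrite !mul0r !addr0 => ->.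
by rewrite -bd; case: bq => ->; rewrite ?mul0r.
Qed.

(** The last two coordinates make the free terms cancel, so they either vanish or come from an edge
    joining z to -z. In the latter case N is unoccupied, and the crossing direction (1, Re (z^2)) is
    too steep for the axis edges that remain. *)
Lemma cells_disjoint_aaff S p q p' q' :
  cells_disjoint S (inr p) (inr q) (inl p') (inl q').
Proof.
move=> a b c d adm s s' a0 b0 c0 d0 bal.
have cd : c = d /\ (c = 0 \/ p' = antipode q').
  apply: dir_balance => //; [have := bal 2%N isT | have := bal 3%N isT];
    rewrite /= dir_antipode !mulr0 addr0; case: (dir q') => ? ? /=; lra.
have [c00|cn0] := eqVneq c 0.
  have d00 : d = 0 by case: cd => <-.
  rewrite c00 d00 in bal *.
  have := @cells_disjoint_aaaa S p q p p a b 0 0 adm s (cell_refl adm s) a0 b0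
    (lexx 0) (lexx 0).
  have bal' : balance a (inr p) b (inr q) 0 (inr p) 0 (inr p).
    by move=> k k4; rewrite bal // !mul0r.
  by move=> /(_ bal') sw x; rewrite sw !mul0r.
case: cd => cd [ce|pq]; first by rewrite ce eqxx in cn0.
exfalso.
have [nanti|nN] := cell_antipodal_N adm.
  by apply: (nanti q'); rewrite -pq; exact: (cell_sym adm).
have pN : p <> axN by move=> e; apply: nN; rewrite -e; apply: (cell_refl adm s).
have qN : q <> axN.
  by move=> e; apply: nN; rewrite -e; apply: (cell_refl adm (cell_sym adm s)).
have fst1 r : r <> axN -> axis_fst R r = 1.
  by rewrite /axis_fst; case: r => [[] []] // /(_ erefl).
have snd1 r : - (1 / 2) <= axis_snd R r <= 1 / 2.
  by rewrite /axis_snd; case: r => [[] []] /=; apply/andP; split; lra.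
have := bal 0%N isT; have := bal 1%N isT.
rewrite /= !fst1 // -cd pq dir_antipode sqrrN.
have := dir_square_bound R q'; move: (Re _) => r.
have /andP[p1 p2] := snd1 p; have /andP[q1 q2] := snd1 q.
move: (axis_snd R p) (axis_snd R q) p1 p2 q1 q2 => y z p1 p2 q1 q2 hr e1 e2.
have c1 : 0 < c by rewrite lt_neqAle eq_sym cn0.
(* The first coordinates give a + b = 2c, so these bounds yield |Re (z^2)| at most 1/2. *)
have h1 : a * y <= a * (1 / 2) by apply: ler_wpM2l.
have h2 : b * z <= b * (1 / 2) by apply: ler_wpM2l.
have h3 : a * - (1 / 2) <= a * y by apply: ler_wpM2l.
have h4 : b * - (1 / 2) <= b * z by apply: ler_wpM2l.
move: hr; rewrite ltNge ler_norml => /negP[]; apply/andP.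
by split; rewrite -(ler_pM2l c1); lra.
Qed.

Lemma cells_disjoint_all S p q p' q' : cells_disjoint S p q p' q'.
Proof.
case: p q p' q' => p [] q [] p' [] q'.
- exact: cells_disjoint_ffff.
- apply: cells_disjoint_swap; apply: cells_disjoint_swapl; apply: cells_disjoint_afff.
- apply: cells_disjoint_swap; apply: cells_disjoint_afff.
- apply: cells_disjoint_swap; apply: cells_disjoint_aaff.
- apply: cells_disjoint_swapl; apply: cells_disjoint_afff.
- apply: cells_disjoint_swapl; apply: cells_disjoint_swapr; apply: cells_disjoint_afaf.
- apply: cells_disjoint_swapl; apply: cells_disjoint_afaf.
- apply: cells_disjoint_swap; apply: cells_disjoint_swapr; apply: cells_disjoint_aaaf.
- exact: cells_disjoint_afff.
- apply: cells_disjoint_swapr; apply: cells_disjoint_afaf.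
- exact: cells_disjoint_afaf.
- apply: cells_disjoint_swap; apply: cells_disjoint_aaaf.
- exact: cells_disjoint_aaff.
- apply: cells_disjoint_swapr; apply: cells_disjoint_aaaf.
- exact: cells_disjoint_aaaf.
- exact: cells_disjoint_aaaa.
Qed.
End Cells.

(** * The embedding and the isotopy *)
Section Embedding.
Variable R : realType.
Local Notation pt := (pt R).
Local Notation S3 := (@S3 R).
Local Notation coords := (@coords R).
Local Open Scope classical_set_scope.
Local Open Scope ring_scope.

Definition row4 (s : seq R) : pt := \row_(i < 4) s`_i.

Local Notation i0 := (@Ordinal 4 0 isT).
Local Notation i1 := (@Ordinal 4 1 isT).
Local Notation i2 := (@Ordinal 4 2 isT).
Local Notation i3 := (@Ordinal 4 3 isT).

Lemma row4P (x y : pt) : x ord0 i0 = y ord0 i0 -> x ord0 i1 = y ord0 i1 ->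
  x ord0 i2 = y ord0 i2 -> x ord0 i3 = y ord0 i3 -> x = y.
Proof.
move=> e0 e1 e2 e3; apply/rowP => -[[|[|[|[|//]]]] k4];
  by rewrite (bool_irrelevance k4 isT).
Qed.

(** * Radial projection of segments to the sphere *)

Definition sqnorm (x : pt) : R := \sum_(i < 4) x ord0 i ^+ 2.

Definition normalize (x : pt) : pt := (Num.sqrt (sqnorm x))^-1 *: x.

Lemma sqnorm_gt0 x : x != 0 -> 0 < sqnorm x.
Proof.
move=> x0; rewrite lt_neqAle sumr_ge0 ?andbT; last by move=> i _; exact: sqr_ge0.
rewrite eq_sym; apply: contra x0; rewrite psumr_eq0; last by move=> i _; exact: sqr_ge0.
move=> /allP h; apply/eqP/rowP => i; rewrite mxE.
by have := h i (mem_index_enum i); rewrite sqrf_eq0 => /eqP.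
Qed.

Lemma sqnormZ c x : sqnorm (c *: x) = c ^+ 2 * sqnorm x.
Proof. by rewrite /sqnorm mulr_sumr; apply: eq_bigr => i _; rewrite mxE exprMn. Qed.

Lemma normalize_S3 x : x != 0 -> S3 (normalize x).
Proof.
move=> /sqnorm_gt0 x0; rewrite /Defs.S3 /= -/(sqnorm _) sqnormZ exprVn sqr_sqrtr ?ltW//.
by rewrite mulVf // gt_eqF.
Qed.

Lemma normalize_eq x y : x != 0 -> y != 0 -> normalize x = normalize y ->
  exists2 c, 0 < c & x = c *: y.
Proof.
move=> /sqnorm_gt0 x0 /sqnorm_gt0 y0 e.
exists (Num.sqrt (sqnorm x) * (Num.sqrt (sqnorm y))^-1).
  by rewrite mulr_gt0 ?invr_gt0 // sqrtr_gt0.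
by rewrite -scalerA -/(normalize y) -e scalerA mulfV ?scale1r // gt_eqF // sqrtr_gt0.
Qed.

Definition vec (p : position) : pt := row4 (coords p).

Definition segment (p q : position) (t : R) : pt := (1 - t) *: vec p + t *: vec q.

Definition arc (p q : position) (t : R) : pt := normalize (segment p q t).

Lemma segmentE p q t k (k4 : (k < 4)%N) :
  segment p q t ord0 (Ordinal k4) = (1 - t) * (coords p)`_k + t * (coords q)`_k.
Proof. by rewrite !mxE. Qed.

Lemma segment_same_weights S p q p' q' s t c : admissible S -> S p q -> S p' q' ->
  0 <= s <= 1 -> 0 <= t <= 1 -> 0 <= c -> segment p q s = c *: segment p' q' t ->
  same_weights (1 - s) p s q (c * (1 - t)) p' (c * t) q'.
Proof.
move=> adm h h' /andP[s0 s1] /andP[t0 t1] c0 e.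
apply: (cells_disjoint_all adm h h') => //; rewrite ?subr_ge0 ?mulr_ge0 ?subr_ge0 //.
move=> k k4; rewrite -segmentE e mxE segmentE; ring.
Qed.

Lemma segment_neq0 S p q t : admissible S -> S p q -> 0 <= t <= 1 -> segment p q t != 0.
Proof.
move=> adm h t01; apply/eqP => e.
(* A zero of the segment equals 0 times that same point, so both weights 1 - t and t, or their sum
   if p = q, would vanish. *)
have sw : same_weights (1 - t) p t q (0 * (1 - t)) p (0 * t) q.
  by apply: (segment_same_weights adm h h) => //; rewrite e scale0r.
have := sw p; have := sw q; rewrite !eqxx !mul0r !mulr1.
by case: eqVneq => _ /=; move: t01 => /andP[]; rewrite ?mulr1 ?mulr0 /=; lra.
Qed.

Lemma segment0 p q : segment p q 0 = vec p.
Proof. by rewrite /segment subr0 scale1r scale0r addr0. Qed.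

Lemma segment1 p q : segment p q 1 = vec q.
Proof. by rewrite /segment subrr scale1r scale0r add0r. Qed.

Lemma segment_rev p q t : segment p q t = segment q p (1 - t).
Proof. by rewrite /segment subKr addrC. Qed.

Lemma cvg_row T (F : set_system T) (FF : Filter F) (f : T -> pt) (l : pt) :
  (forall i, f x ord0 i @[x --> F] --> l ord0 i) -> f @ F --> l.
Proof.
move=> fl; apply/cvg_ballP => e e0.
have H : \forall x \near F, forall i, ball (l ord0 i) e (f x ord0 i).
  by apply: filter_forall => i; move/cvg_ballP: (fl i); exact.
by apply: filterS H => x H; split => // i j; rewrite ord1; exact: H.
Qed.

Lemma arc_continuous p q t : segment p q t != 0 -> {for t, continuous (arc p q)}.
Proof.
move=> /sqnorm_gt0 st.
have cs i : {for t, continuous (fun u => segment p q u ord0 i)}.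
  rewrite /prop_for /continuous_at.
  have E u : segment p q u ord0 i = (1 - u) * vec p ord0 i + u * vec q ord0 i.
    by rewrite /segment !mxE.
  rewrite E (funext E); apply: cvgD; apply: cvgM; try exact: cvg_cst; last exact: cvg_id.
  by apply: cvgB; [exact: cvg_cst|exact: cvg_id].
have cn : (fun u => sqnorm (segment p q u)) @ t --> sqnorm (segment p q t).
  apply: cvg_big => [|i _]; first exact: add_continuous.
  exact: (cvg_comp _ _ (cs i) (@exprn_continuous R 2 _)).
have cq : (fun u => (Num.sqrt (sqnorm (segment p q u)))^-1) @ t -->
    (Num.sqrt (sqnorm (segment p q t)))^-1.
  apply: cvgV; first by rewrite gt_eqF // sqrtr_gt0.
  exact: (cvg_comp _ _ cn (@sqrt_continuous R _)).
apply: cvg_row => i.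
have -> : (fun u => arc p q u ord0 i) =
    (fun u => (Num.sqrt (sqnorm (segment p q u)))^-1 * segment p q u ord0 i).
  by apply/funext => u; rewrite /arc /normalize mxE.
rewrite /arc /normalize mxE; apply: cvgM; [exact: cq|exact: cs].
Qed.

(** * The rotoreflection h and the rotation isotopy *)

Definition axis_turn (c : axis_pos) : axis_pos := if c.1 then c else (false, ~~ c.2).

Definition turn (p : position) : position :=
  match p with
  | inl a => inl (quarter_turn a)
  | inr c => inr (axis_turn c)
  end.

Definition rotoreflection (x : pt) : pt :=
  row4 [:: x ord0 i0; - x ord0 i1; - x ord0 i3; x ord0 i2].

Lemma sum_ord4 (F : 'I_4 -> R) : \sum_(i < 4) F i = F i0 + F i1 + F i2 + F i3.
Proof.
rewrite !big_ord_recr big_ord0 /= add0r.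
by congr (_ + _ + _ + _); congr F; apply: val_inj.
Qed.

Lemma vec_turn p : vec (turn p) = rotoreflection (vec p).
Proof.
case: p => [a|[[] []]]; apply: row4P; rewrite !mxE /= ?oppr0 //.
- by rewrite dir_quarter_turn !expr2; case: (dir R a) => x y /=; ring.
- by rewrite dir_quarter_turn; case: (dir R a) => x y /=; ring.
- by rewrite dir_quarter_turn; case: (dir R a) => x y /=; ring.
- by rewrite /axis_snd /= opprK.
Qed.

Lemma rotoreflection_lin a x b y : rotoreflection (a *: x + b *: y) =
  a *: rotoreflection x + b *: rotoreflection y.
Proof. by apply: row4P; rewrite !mxE /=; ring. Qed.

Lemma rotoreflection_normalize x :
  rotoreflection (normalize x) = normalize (rotoreflection x).
Proof.
have -> : normalize (rotoreflection x) = (Num.sqrt (sqnorm x))^-1 *: rotoreflection x.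
  by rewrite /normalize /sqnorm !sum_ord4 !mxE /=; congr ((Num.sqrt _)^-1 *: _); ring.
by apply: row4P; rewrite !mxE /=; ring.
Qed.

Lemma rotoreflection_arc p q t : rotoreflection (arc p q t) = arc (turn p) (turn q) t.
Proof.
by rewrite /arc rotoreflection_normalize /segment rotoreflection_lin !vec_turn.
Qed.

Lemma rotoreflection4 x :
  rotoreflection (rotoreflection (rotoreflection (rotoreflection x))) = x.
Proof. by apply: row4P; rewrite !mxE /= ?mxE /= ?opprK. Qed.

(* Rotation by the angles pi t and pi t / 2 in the two coordinate planes; at
   t = 1 it is the rotoreflection followed by the mirror. *)
Definition rotation (x : pt) (t : R) : pt :=
  let u := pi * t in let v := pi / 2 * t in
  row4 [:: cos u * x ord0 i0 - sin u * x ord0 i1; sin u * x ord0 i0 + cos u * x ord0 i1;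
           cos v * x ord0 i2 - sin v * x ord0 i3; sin v * x ord0 i2 + cos v * x ord0 i3].

Lemma rotation0 x : rotation x 0 = x.
Proof.
by apply: row4P; rewrite !mxE /= !mulr0 cos0 sin0; ring.
Qed.

Lemma rotation1 x : rotation x 1 = mirror (rotoreflection x).
Proof.
apply: row4P; rewrite !mxE /= ?mxE /= !mulr1 ?cospi ?sinpi ?cos_pihalf ?sin_pihalf; ring.
Qed.

Lemma rotationK x t : rotation (rotation x t) (- t) = x.
Proof.
apply: row4P; rewrite !mxE /= !mulrN cosN sinN.
- by transitivity ((cos (pi * t) ^+ 2 + sin (pi * t) ^+ 2) * x ord0 i0);
    [ring|rewrite cos2Dsin2 mul1r].
- by transitivity ((cos (pi * t) ^+ 2 + sin (pi * t) ^+ 2) * x ord0 i1);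
    [ring|rewrite cos2Dsin2 mul1r].
- by transitivity ((cos (pi / 2 * t) ^+ 2 + sin (pi / 2 * t) ^+ 2) * x ord0 i2);
    [ring|rewrite cos2Dsin2 mul1r].
- by transitivity ((cos (pi / 2 * t) ^+ 2 + sin (pi / 2 * t) ^+ 2) * x ord0 i3);
    [ring|rewrite cos2Dsin2 mul1r].
Qed.

Lemma rotation_S3 x t : S3 x -> S3 (rotation x t).
Proof.
rewrite /Defs.S3 /= !sum_ord4 !mxE /= => x1.
set u := pi * t; set v := pi / 2 * t.
transitivity ((cos u ^+ 2 + sin u ^+ 2) * (x ord0 i0 ^+ 2 + x ord0 i1 ^+ 2)
  + (cos v ^+ 2 + sin v ^+ 2) * (x ord0 i2 ^+ 2 + x ord0 i3 ^+ 2)); first by ring.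
by rewrite !cos2Dsin2 !mul1r addrA.
Qed.

Lemma rotation_continuous : continuous (fun z : pt * R => rotation z.1 z.2).
Proof.
move=> [x t]; apply: cvg_row => i.
have cx j : (fun z : pt * R => z.1 ord0 j) @ (x, t) --> x ord0 j.
  apply: (@cvg_comp _ _ _ fst (fun M : pt => M ord0 j) _ (nbhs x)).
    exact: cvg_fst.
  exact: coord_continuous.
have ct (c : R) : (fun z : pt * R => c * z.2) @ (x, t) --> c * t.
  by apply: cvgM; [exact: cvg_cst|exact: cvg_snd].
have cc (c : R) : (fun z : pt * R => cos (c * z.2)) @ (x, t) --> cos (c * t).
  exact: (cvg_comp _ _ (ct c) (@continuous_cos R _)).
have cs (c : R) : (fun z : pt * R => sin (c * z.2)) @ (x, t) --> sin (c * t).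
  exact: (cvg_comp _ _ (ct c) (@continuous_sin R _)).
case: i => -[|[|[|[|//]]]] k4; rewrite /rotation /=.
all: under eq_fun do rewrite mxE /=; rewrite mxE /=.
all: try (by apply: cvgB; apply: cvgM).
all: by apply: cvgD; apply: cvgM.
Qed.

Lemma rotation_homeo t : homeo_S3 (fun x => rotation x t).
Proof.
have ct (s : R) : {within S3, continuous (fun x => rotation x s)}.
  apply: continuous_subspaceT => x.
  have H : (fun y : pt => (y, s)) @ x --> (x, s)
    by exact: (cvg_pair (F := nbhs x) cvg_id (cvg_cst (F := nbhs x) s)).
  exact: (cvg_comp _ _ H (@rotation_continuous (x, s))).
split; first by move=> x; exact: rotation_S3.
split=> //; exists (fun x => rotation x (- t)); split; first by move=> x; exact: rotation_S3.
split=> //; split=> x _; first exact: rotationK.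
by rewrite -{2}(opprK t) rotationK.
Qed.

(** The rotation ends at mirror o h, and h maps A onto itself: h^4 is the identity, so h^3 x is a
    preimage of x in A. *)
Lemma rotation_isotopic (A : set pt) : (forall x, A x -> A (rotoreflection x)) ->
  ambient_isotopic A ((@mirror R) @` A).
Proof.
move=> hA; exists rotation; split.
  exact: continuous_subspaceT rotation_continuous.
split; first by move=> t _; exact: rotation_homeo.
split; first by move=> x _; exact: rotation0.
apply/seteqP; split => y [x Ax <-].
  by exists (rotoreflection x); [exact: hA|rewrite rotation1].
exists (rotoreflection (rotoreflection (rotoreflection x))); first exact: hA (hA _ (hA _ Ax)).
by rewrite rotation1 rotoreflection4.
Qed.

(** * From a layout of the vertices to an achiral embedding *)

Definition cells_of (G : graph) (f : vert G -> position) (p q : position) : Prop :=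
  exists u v, [/\ f u = p, f v = q & u = v \/ adj u v].

Record layout (G : graph) (f : vert G -> position) : Prop := Layout {
  layout_inj : injective f;
  layout_irr : forall u : vert G, ~~ adj u u;
  layout_sym : forall u v : vert G, adj u v -> adj v u;
  layout_adm : admissible (cells_of f);
  layout_turn : forall u, exists u', f u' = turn (f u);
  layout_adj : forall u v u' v', f u' = turn (f u) -> f v' = turn (f v) ->
    adj u v -> adj u' v' }.

Lemma layout_achiral (G : graph) (f : vert G -> position) :
  layout f -> achirally_embeddable R G.
Proof.
case=> inj irr sym adm trn trnA.
have cell (u v : vert G) : adj u v -> cells_of f (f u) (f v) by move=> e; exists u, v; split=> //; right.
have cell1 u : cells_of f (f u) (f u) by exists u, u; split=> //; left.
have itv0 (t : R) : t \in `[0, 1] -> 0 <= t <= 1 by rewrite in_itv.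
have itv1 (t : R) : t \in `]0, 1[ -> 0 < t < 1 by rewrite in_itv.
have normal u : normalize (vec (f u)) = arc (f u) (f u) 0.
  by rewrite /arc segment0.
exists (fun u => normalize (vec (f u))), (fun u v => arc (f u) (f v)).
(* A common point of two arcs means proportional points of the segments, hence vertex weights that
   agree up to a factor c > 0. All remaining embedding conditions on injectivity and disjointness
   follow by comparing weights. *)
have meet u v u' v' s t : cells_of f (f u) (f v) -> cells_of f (f u') (f v') ->
    0 <= s <= 1 -> 0 <= t <= 1 -> arc (f u) (f v) s = arc (f u') (f v') t ->
    exists2 c, 0 < c & forall x, (1 - s) * (u == x)%:R + s * (v == x)%:R =
      c * (1 - t) * (u' == x)%:R + c * t * (v' == x)%:R.
  move=> h h' s01 t01 e.
  have [c c0 ec] := normalize_eq (segment_neq0 adm h s01) (segment_neq0 adm h' t01) e.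
  exists c => // x; have := segment_same_weights adm h h' s01 t01 (ltW c0) ec (f x).
  by rewrite !(inj_eq inj).
split; last first.
  apply: rotation_isotopic => x [[w ->]|[u [v [t [uv [t01 ->]]]]]].
    have [w' ew] := trn w; left; exists w'.
    by rewrite rotoreflection_normalize ew vec_turn.
  have [[u' eu] [v' ev]] := (trn u, trn v).
  right; exists u', v', t; split; first exact: trnA eu ev uv.
  by rewrite rotoreflection_arc eu ev.
have irrE (u v : vert G) : adj u v -> (u == v) = false.
  by move=> uv; apply/negP => /eqP e; move: (irr u); rewrite {2}e uv.
have z01 : 0 <= (0 : R) <= 1 by rewrite lexx ler01.
split; first by move=> u; rewrite normal; apply/normalize_S3/(segment_neq0 adm (cell1 u)).
split.
  move=> u v; rewrite !normal => e; apply/eqP/negPn/negP => uv.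
  have [c c0 /(_ u)] := meet _ _ _ _ _ _ (cell1 u) (cell1 v) z01 z01 e.
  by rewrite eqxx eq_sym (negbTE uv) /=; lra.
split.
  move=> u v uv; split.
    apply: continuous_in_subspaceT => t /set_mem/itv0 t01.
    exact/arc_continuous/(segment_neq0 adm (cell _ _ uv)).
  split; first by rewrite /arc segment0.
  split; first by rewrite /arc segment1.
  move=> t /itv0 t01; split; first exact/normalize_S3/(segment_neq0 adm (cell _ _ uv)).
  by rewrite /arc segment_rev.
split.
  move=> u v w t uv /itv1/andP[t0 t1]; rewrite normal => e.
  have t01 : 0 <= t <= 1 by rewrite !ltW.
  have [c c0 H] := meet _ _ _ _ _ _ (cell _ _ uv) (cell1 w) t01 z01 e.
  have := H u; have := H v; rewrite !eqxx (irrE u v uv) [v == u]eq_sym (irrE u v uv).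
  case: (eqVneq w u) => [->|_]; last by case: eqVneq => _ /=; lra.
  by rewrite (irrE u v uv) /=; lra.
move=> u v u' v' s t uv uv' /itv1/andP[s0 s1] /itv1/andP[t0 t1] e.
have s01 : 0 <= s <= 1 by rewrite !ltW.
have t01 : 0 <= t <= 1 by rewrite !ltW.
have [c c0 H] := meet _ _ _ _ _ _ (cell _ _ uv) (cell _ _ uv') s01 t01 e.
have := H u; have := H v; rewrite !eqxx (irrE u v uv) [v == u]eq_sym (irrE u v uv).
have ct : 0 < c * t by apply: mulr_gt0.
have ct' : 0 < c * (1 - t) by apply: mulr_gt0 => //; lra.
case: (eqVneq u' u) => [eu|_].
  have -> : (v' == u) = false by rewrite -eu eq_sym (irrE u' v' uv').
  rewrite eu (irrE u v uv); case: (eqVneq v' v) => [ev|_] /= h1 h2; last by exfalso; lra.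
  (* The two weights on either side add up to 1 and to c. *)
  have c1 : c = 1 by lra.
  by left; rewrite c1 in h1 h2; do 2 split => //; lra.
case: (eqVneq v' u) => [ev|_] /=; last by move=> _ h; exfalso; lra.
rewrite ev (irrE u v uv); case: (eqVneq u' v) => [eu|_] /= h1 h2; last by exfalso; lra.
have c1 : c = 1 by lra.
by right; rewrite c1 in h1 h2; do 2 split => //; lra.
Qed.
End Embedding.

(** * Symmetric placements of the vertices *)
Local Open Scope nat_scope.

Definition loopfree (G : graph) : Prop := forall u : vert G, ~~ adj u u.
Definition undirected (G : graph) : Prop := forall u v : vert G, adj u v -> adj v u.

(* Kept opaque, since [pickle] must not be evaluated on numerals. *)
Fact orbit_spec : {f : nat -> nat -> nat -> nat | forall t i j t' i' j',
  f t i j = f t' i' j' -> [/\ t = t', i = i' & j = j']}.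
Proof.
by exists (fun t i j => pickle (t, i, j)) => t i j t' i' j' /(pcan_inj pickleK) [-> -> ->].
Qed.

(** The first argument keeps the joined graphs apart: 0 for $4G_1$, 1 for $2G_2$, 2 for $G_3$ and 3
    for $K_{q_1,q_2,q_3}$. *)
Definition orbit : nat -> nat -> nat -> nat := sval orbit_spec.

Lemma orbit_inj t i j t' i' j' :
  orbit t i j = orbit t' i' j' -> [/\ t = t', i = i' & j = j'].
Proof. exact: (svalP orbit_spec). Qed.

Lemma antipodeE a : antipode a = quarter_turn (quarter_turn a).
Proof. by case: a => n [[] []]. Qed.

Record symmetric_placement (G : graph) (f : vert G -> position) : Prop := SymmetricPlacement {
  sp_inj : injective f;
  sp_turn : forall u, exists u', f u' = turn (f u);
  sp_adj : forall u v u' v', f u' = turn (f u) -> f v' = turn (f v) ->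
    adj u v -> adj u' v' }.

Definition no_antipodal_edge (G : graph) (f : vert G -> position) : Prop :=
  forall u v a, adj u v -> f u = inl a -> f v = inl (antipode a) -> False.

Definition off_axis (G : graph) (f : vert G -> position) : Prop :=
  forall u c, f u <> inr c.

Record axis_compatible (G : graph) (f : vert G -> position) : Prop := AxisCompatible {
  ac_ON : forall u v, adj u v -> f u = inr axO -> f v = inr axN -> False;
  ac_ABO : (forall u v, adj u v -> f u = inr axA -> f v = inr axB -> False) \/
    (forall u, f u <> inr axO) }.

Lemma placement_layout (G : graph) (f : vert G -> position) :
  loopfree G -> undirected G -> symmetric_placement f -> axis_compatible f ->
  no_antipodal_edge f \/ (forall u, f u <> inr axN) -> layout f.
Proof.
move=> irr sym [inj trn trnA] [ON AB] oppN; split=> //.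
split.
- by move=> p q [u [v [<- <- [->|/sym uv]]]]; exists v; [exists v|exists u]; split=> //; [left|right].
- by move=> p q [u [v [<- _ _]]]; exists u, u; split=> //; left.
- by move=> [u [v [eu ev [uv|uv]]]]; [move: eu; rewrite uv ev|exact: ON uv eu ev].
- case: AB => [AB|nO]; [left|right].
  + by move=> [u [v [eu ev [uv|uv]]]]; [move: eu; rewrite uv ev|exact: AB uv eu ev].
  + by move=> [u [v [eu _ _]]]; exact: nO eu.
- case: oppN => [opp|nN]; [left|right].
  + move=> a [u [v [eu ev [uv|uv]]]]; last exact: opp uv eu ev.
    by move: eu; rewrite uv ev; case: (a) => n [b []].
  + by move=> [u [v [eu _ _]]]; exact: nN eu.
Qed.

(** * Joins of placements *)

Definition join_placement (G H : graph) (f : vert G -> position) (g : vert H -> position)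
  (u : vert (gjoin G H)) : position := match u with inl x => f x | inr y => g y end.

Section Join.
Variables (G H : graph) (f : vert G -> position) (g : vert H -> position).
Hypotheses (fP : symmetric_placement f) (gP : symmetric_placement g).
Hypothesis fg : forall u v, f u <> g v.

Lemma join_symmetric_placement : symmetric_placement (join_placement f g).
Proof.
have fturn u v : f v <> turn (g u) by have [u' <-] := sp_turn gP u; apply: fg.
have gturn u v : g v <> turn (f u) by have [u' <-] := sp_turn fP u => /esym; apply: fg.
split.
- case=> u [] v /=; first by move/(sp_inj fP) ->.
  + by move/fg.
  + by move/esym/fg.
  + by move/(sp_inj gP) ->.
- case=> u; first by have [u' e] := sp_turn fP u; exists (inl u').
  by have [u' e] := sp_turn gP u; exists (inr u').
- case=> u [] v [] u' [] v' //= eu ev; do ?[by case: (fturn _ _ eu) | by case: (fturn _ _ ev)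
    | by case: (gturn _ _ eu) | by case: (gturn _ _ ev)].
  + exact: sp_adj eu ev.
  + exact: sp_adj eu ev.
Qed.

(** Edges between the two factors are never antipodal: [antipode] is [turn] applied twice, so it
    preserves the set of positions of each factor, and these sets are disjoint. *)
Lemma join_no_antipodal_edge : no_antipodal_edge f -> no_antipodal_edge g ->
  no_antipodal_edge (join_placement f g).
Proof.
have anti K (k : vert K -> position) u a : symmetric_placement k -> k u = inl a ->
    exists u', k u' = inl (antipode a).
  move=> kP e; have [v ev] := sp_turn kP u; have [w ew] := sp_turn kP v.
  by exists w; rewrite ew ev e antipodeE.
move=> nf ng [u|u] [v|v] a //= uv eu ev; first exact: nf uv eu ev.
- by have [u' e] := anti _ _ _ _ fP eu; apply: (fg (u := u') (v := v)); rewrite e ev.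
- by have [u' e] := anti _ _ _ _ gP eu; apply: (fg (u := v) (v := u')); rewrite e ev.
- exact: ng uv eu ev.
Qed.

Lemma join_axis_compatible : off_axis f -> axis_compatible g ->
  axis_compatible (join_placement f g).
Proof.
move=> nf [ON AB]; split.
  by case=> u [] v //= uv; [move/nf|move/nf|move=> _ /nf|exact: ON].
case: AB => [AB|nO]; [left|right].
  by case=> u [] v //= uv; [move/nf|move/nf|move=> _ /nf|exact: AB].
by case=> u //=; exact: nf.
Qed.
End Join.

Lemma loopfree_join G H : loopfree G -> loopfree H -> loopfree (gjoin G H).
Proof. by move=> lG lH []. Qed.

Lemma undirected_join G H : undirected G -> undirected H -> undirected (gjoin G H).
Proof. by move=> uG uH [u|u] [v|v] //=; [exact: uG|exact: uH]. Qed.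

Lemma loopfree_njoin n G : loopfree G -> loopfree (njoin n G).
Proof. by move=> lG; elim: n => [[]|n IH] //=; exact: loopfree_join. Qed.

Lemma undirected_njoin n G : undirected G -> undirected (njoin n G).
Proof. by move=> uG; elim: n => [[]|n IH] //=; exact: undirected_join. Qed.

Lemma loopfree_cmp s : loopfree (cmp s).
Proof. by move=> u /=; rewrite eqxx. Qed.

Lemma undirected_cmp s : undirected (cmp s).
Proof. by move=> u v /=; rewrite eq_sym. Qed.

(** * Placements of $4G_1$, $G_3$ and $2G_2$ in long orbits *)

Definition quadruple_placement (G : graph) (u : vert (njoin 4 G)) : position :=
  let pos (x : vert G) b := inl (orbit 0 (enum_rank x) 0, b) in
  match u with
  | inl x => pos x (false, false)
  | inr (inl x) => pos x (true, false)
  | inr (inr (inl x)) => pos x (false, true)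
  | inr (inr (inr (inl x))) => pos x (true, true)
  | inr (inr (inr (inr v))) => match v with end
  end.

Lemma symmetric_placement_map (G : graph) (f : vert G -> position) (s : vert G -> vert G) :
  injective f -> (forall u, f (s u) = turn (f u)) ->
  (forall u v, adj u v -> adj (s u) (s v)) -> symmetric_placement f.
Proof.
move=> inj fs adjs; split=> // [u|u v u' v']; first by exists (s u).
by rewrite -!fs => /inj-> /inj->; exact: adjs.
Qed.

(** The copies of a vertex sit at z, iz, -z and -iz, and [s] shifts the copies cyclically. The
    copies at z and -z are adjacent, so a nonempty $G_1$ always creates antipodal edges. *)
Lemma quadruple_symmetric_placement G : symmetric_placement (@quadruple_placement G).
Proof.
pose s (u : vert (njoin 4 G)) : vert (njoin 4 G) := match u with
  | inl x => inr (inl x)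
  | inr (inl x) => inr (inr (inl x))
  | inr (inr (inl x)) => inr (inr (inr (inl x)))
  | inr (inr (inr (inl x))) => inl x
  | inr (inr (inr (inr v))) => match v with end
  end.
apply: (@symmetric_placement_map _ _ s).
- by case=> [u|[u|[u|[u|[]]]]] [v|[v|[v|[v|[]]]]] //= []
    /orbit_inj[_ /val_inj/enum_rank_inj -> _].
- by case=> [u|[u|[u|[u|[]]]]].
- by case=> [u|[u|[u|[u|[]]]]] [v|[v|[v|[v|[]]]]].
Qed.

Definition valid (s : seq nat) (i j : nat) : bool := (i < size s) && (j < nth 0 s i).

Lemma valid_tag s (u : vert (cmp s)) : valid s (tag u) (tagged u).
Proof. by rewrite /valid !ltn_ord. Qed.

Lemma valid_vertex s i j : valid s i j ->
  exists u : vert (cmp s), nat_of_ord (tag u) = i /\ nat_of_ord (tagged u) = j.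
Proof. by move=> /andP[hi hj]; exists (existT _ (Ordinal hi) (Ordinal hj)). Qed.

Lemma vertex_eq s (u v : vert (cmp s)) :
  nat_of_ord (tag u) = tag v -> nat_of_ord (tagged u) = tagged v -> u = v.
Proof.
case: u v => [i j] [i' j'] /= /val_inj e; move: j'; rewrite -{i'}e => j' /val_inj ->.
by [].
Qed.

(** A symmetric placement in terms of part and vertex numbers, which avoids the dependent vertex
    type. The last field says that [turn] keeps distinct parts distinct. *)
Record multipartite_placement (s : seq nat) (P : nat -> nat -> position) : Prop :=
  MultipartitePlacement {
  mp_inj : forall i j i' j', valid s i j -> valid s i' j' -> P i j = P i' j' ->
    i = i' /\ j = j';
  mp_turn : forall i j, valid s i j ->
    exists i' j', valid s i' j' /\ P i' j' = turn (P i j);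
  mp_part : forall i j k l i' j' k' l', valid s i j -> valid s k l ->
    valid s i' j' -> valid s k' l' ->
    P i' j' = turn (P i j) -> P k' l' = turn (P k l) -> i' = k' -> i = k }.

Definition cmp_placement s (P : nat -> nat -> position) (u : vert (cmp s)) : position :=
  P (tag u) (tagged u).

Lemma cmp_symmetric_placement s P :
  multipartite_placement s P -> symmetric_placement (@cmp_placement s P).
Proof.
move=> [inj trn prt]; split.
- by move=> u v /inj[] ; [exact: valid_tag|exact: valid_tag|move=> ? ?; apply: vertex_eq].
- move=> u; have [i [j [/valid_vertex[v [<- <-]] e]]] := trn _ _ (valid_tag u).
  by exists v.
- move=> u v u' v' eu ev /= uv; apply: contra uv => /eqP uv'; apply/eqP/val_inj.
  apply: prt eu ev _; try exact: valid_tag.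
  by rewrite uv'.
Qed.

(** Each block of four consecutive vertices of part [i] is one orbit, vertex [j] having exponent j
    mod 4 of i. *)
Definition quarter_placement (t i j : nat) : position :=
  inl (orbit t i (j %/ 4), (odd j, odd (j %/ 2))).

Lemma odd_pair_inj j j' : j %/ 4 = j' %/ 4 -> odd j = odd j' -> odd (j %/ 2) = odd (j' %/ 2) ->
  j = j'.
Proof. lia. Qed.

Lemma quarter_placement_turn t i j : exists2 j', j' %/ 4 = j %/ 4 &
  quarter_placement t i j' = turn (quarter_placement t i j).
Proof.
(* The cyclic successor of [j] within its block of four. *)
exists (if j %% 4 == 3 then j - 3 else j.+1); first by case: eqP; lia.
rewrite /quarter_placement /turn /quarter_turn /=; congr (inl (orbit _ _ _, (_, _)));
  by case: eqP => /=; lia.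
Qed.

Lemma four_dvd_symmetric_placement s : all (fun m => 4 %| m) s ->
  symmetric_placement (@cmp_placement s (quarter_placement 2)).
Proof.
move=> /all_nthP s4; apply: cmp_symmetric_placement; split.
- move=> i j i' j' _ _ [] /orbit_inj[_ -> q] o1 o2; split=> //; exact: odd_pair_inj.
- move=> i j /andP[hi hj]; have [j' q e] := quarter_placement_turn 2 i j.
  exists i, j'; split=> //; rewrite /valid hi /=.
  by have := s4 0 _ hi; move: (nth 0 s i) hj => n; lia.
- move=> i j k l i' j' k' l' _ _ _ _.
  by move=> [] /orbit_inj[_ -> _] _ _ [] /orbit_inj[_ -> _] _ _.
Qed.

Lemma four_dvd_no_antipodal_edge s :
  no_antipodal_edge (@cmp_placement s (quarter_placement 2)).
Proof.
move=> u v a uv [<-] [] /orbit_inj[_ /val_inj e _] _ _.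
by move: uv; rewrite /= e eqxx.
Qed.

(** Exchanges vertices 2k and 2k+1 of a part; the default of [insubd] is reached only at the last
    vertex of a part of odd size. *)
Definition flip_vertex s (u : vert (cmp s)) : vert (cmp s) :=
  let j := nat_of_ord (tagged u) in
  Tagged (fun i : 'I_(size s) => 'I_(nth 0 s i))
    (insubd (tagged u) (if odd j then j.-1 else j.+1)).

(** Vertices 2k and 2k+1 of a part sit at z and -z in the first copy and at iz and -iz in the
    second. Antipodal vertices thus share a part. *)
Definition double_placement s (u : vert (njoin 2 (cmp s))) : position :=
  let pos b (x : vert (cmp s)) :=
    inl (orbit 1 (tag x) (tagged x %/ 2), (b, odd (tagged x))) in
  match u with
  | inl x => pos false x
  | inr (inl x) => pos true x
  | inr (inr v) => match v with end
  end.

Lemma even_symmetric_placement s : all (fun m => ~~ odd m) s ->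
  symmetric_placement (@double_placement s).
Proof.
move=> /all_nthP s2.
pose r (u : vert (njoin 2 (cmp s))) : vert (njoin 2 (cmp s)) := match u with
  | inl x => inr (inl x)
  | inr (inl x) => inl (flip_vertex x)
  | inr (inr v) => match v with end
  end.
have inj (x y : vert (cmp s)) :
    orbit 1 (tag x) (tagged x %/ 2) = orbit 1 (tag y) (tagged y %/ 2) ->
    odd (tagged x) = odd (tagged y) -> x = y.
  by move=> /orbit_inj[_ e q] o; apply: vertex_eq => //; lia.
apply: (@symmetric_placement_map _ _ r).
- by case=> [u|[u|[]]] [v|[v|[]]] //= [] /inj e /e ->.
- case=> [u|[u|[]]] //=.
  have -> : nat_of_ord (tagged (flip_vertex u)) =
      if odd (tagged u) then (tagged u).-1 else (tagged u).+1 :> nat.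
    move: (s2 0 _ (ltn_ord (tag u))).
    rewrite /flip_vertex /= val_insubd; case: u => i [j hj] /=.
    move: (nth 0 s i) hj => n hj n2; case: ifP; case: ifP; lia.
  by rewrite /quarter_turn /=; congr (inl (orbit _ _ _, (_, _))); case: ifP; lia.
- by case=> [u|[u|[]]] [v|[v|[]]].
Qed.

Lemma even_no_antipodal_edge s : no_antipodal_edge (@double_placement s).
Proof.
move=> [u|[u|[]]] [v|[v|[]]] a uv [<-] //= [] /orbit_inj[_ /val_inj e _] _;
  by move: uv; rewrite /= e eqxx.
Qed.

(** * Placements of $K_{q_1,q_2,q_3}$, including the leftover vertices *)

Record core_placement (s : seq nat) (P : nat -> nat -> position) : Prop := CorePlacement {
  cp_mp : multipartite_placement s P;
  cp_block : forall i j n b, P i j = inl (n, b) -> exists i' j', n = orbit 3 i' j';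
  cp_no_antipodal : forall i j i' j' a, valid s i j -> valid s i' j' ->
    P i j = inl a -> P i' j' = inl (antipode a) -> i = i';
  cp_ON : forall i j i' j', valid s i j -> valid s i' j' ->
    P i j = inr axO -> P i' j' = inr axN -> i = i';
  cp_ABO : (forall i j i' j', valid s i j -> valid s i' j' ->
     P i j = inr axA -> P i' j' = inr axB -> i = i') \/
    (forall i j, valid s i j -> P i j <> inr axO) }.

Definition avoids_N (s : seq nat) (P : nat -> nat -> position) : Prop :=
  forall i j, valid s i j -> P i j <> inr axN.

Lemma core_placement_perm s t P : perm_eq s t -> core_placement t P ->
  exists P', core_placement s P' /\ (avoids_N t P -> avoids_N s P').
Proof.
move=> /(perm_iotaP 0)[I permI sE] [[inj trn prt] blk opp ON AB].
have sI : size s = size I by rewrite sE size_map.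
have szI : size I = size t by rewrite (perm_size permI) size_iota.
(* [r] sends the number of a part of [s] to the number of the matching part of [t]. *)
pose r := nth 0 I.
have r_size i : i < size I -> r i < size t.
  by move=> iI; have := mem_nth 0 iI; rewrite (perm_mem permI) mem_iota.
have val_r i j : valid s i j -> valid t (r i) j.
  by rewrite /valid sI => /andP[iI]; rewrite sE (nth_map 0) // r_size.
have r_inj i j i' j' : valid s i j -> valid s i' j' -> r i = r i' -> i = i'.
  rewrite /valid sI => /andP[iI _] /andP[iI' _] /eqP.
  by rewrite nth_uniq // ?(perm_uniq permI) ?iota_uniq // => /eqP.
have r_surj k j : valid t k j -> exists2 i, r i = k & valid s i j.
  move=> /andP[kt kj]; have kI : k \in I by rewrite (perm_mem permI) mem_iota.
  have iI : index k I < size I by rewrite index_mem.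
  exists (index k I); first exact: nth_index.
  by rewrite /valid sI iI sE (nth_map 0) // nth_index.
exists (fun i => P (r i)); split; last by move=> nN i j /val_r; exact: nN.
split; first split.
- move=> i j i' j' v v' e; have [e1 e2] := inj _ _ _ _ (val_r _ _ v) (val_r _ _ v') e.
  by split=> //; exact: r_inj v v' e1.
- move=> i j v; have [k [j' [vk e]]] := trn _ _ (val_r _ _ v).
  by have [i' ri' vi'] := r_surj _ _ vk; exists i', j'; rewrite ri'.
- move=> i j k l i' j' k' l' v1 v2 v3 v4 e1 e2 e3; apply: (r_inj _ _ _ _ v1 v2).
  by apply: prt e1 e2 _; rewrite ?e3 //; apply: val_r => //; rewrite -e3.
- by move=> i j n b /blk.
- move=> i j i' j' a v v' e e'; apply: (r_inj _ _ _ _ v v').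
  by apply: opp e e'; exact: val_r.
- move=> i j i' j' v v' e e'; apply: (r_inj _ _ _ _ v v').
  by apply: ON e e'; exact: val_r.
- case: AB => [AB|nO]; [left|right].
    move=> i j i' j' v v' e e'; apply: (r_inj _ _ _ _ v v').
    by apply: AB e e'; exact: val_r.
  by move=> i j /val_r; exact: nO.
Qed.

(** The first vertices of part [i] take the axis positions listed in [L i]; the rest form orbits of
    four inside the part. *)
Definition leftover_placement (L : nat -> seq axis_pos) (i j : nat) : position :=
  if j < size (L i) then inr (nth axO (L i) j)
  else quarter_placement 3 i (j - size (L i)).

(** Every part is preserved by [turn]. By the last hypothesis A and B can only occur in the same
    part, and likewise O and N, so neither pair is joined by an edge. *)
Lemma leftover_core_placement s L :
  (forall i, i < size s -> exists k, nth 0 s i = size (L i) + 4 * k) ->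
  (forall i, uniq (L i)) ->
  (forall i c, c \in L i -> axis_turn c \in L i) ->
  (forall i i' c c', c \in L i -> c' \in L i' -> c.1 = c'.1 -> i = i') ->
  core_placement s (leftover_placement L).
Proof.
move=> sizeL uniqL turnL sepL.
have mem i j : j < size (L i) -> nth axO (L i) j \in L i by apply: mem_nth.
have axis i j c : leftover_placement L i j = inr c -> c \in L i.
  by rewrite /leftover_placement; case: ifP => // /mem h [<-].
have free i j n b : leftover_placement L i j = inl (n, b) ->
    n = orbit 3 i ((j - size (L i)) %/ 4).
  by rewrite /leftover_placement; case: ifP => // _ [<-].
have turn1 c : (axis_turn c).1 = c.1 by case: c => [[] []].
have part i j i' j' : leftover_placement L i' j' = turn (leftover_placement L i j) -> i' = i.
  case e : (leftover_placement L i j) => [[n b]|c] /= e'.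
    by move: (free _ _ _ _ e') (free _ _ _ _ e) => /= -> /orbit_inj[].
  by apply: sepL (axis _ _ _ e') (axis _ _ _ e) _.
split; first split.
- move=> i j i' j' _ _ e; case e1 : (leftover_placement L i j) (e) => [[n b]|c] /esym e2.
    have ii : i = i' by move: (free _ _ _ _ e1) (free _ _ _ _ e2) => -> /orbit_inj[].
    subst i'; split=> //; move: e1 e2; rewrite /leftover_placement.
    case: ltnP => // h [<- <-]; case: ltnP => // h' [] /orbit_inj[_ _ q] o1 o2.
    by rewrite -(subnK h) -(subnK h') (odd_pair_inj q o1 o2).
  have ii : i = i' by exact: sepL (axis _ _ _ e1) (axis _ _ _ e2) erefl.
  subst i'; split=> //; move: e1 e2; rewrite /leftover_placement.
  case: ifP => // h [<-]; case: ifP => // h' [] /eqP.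
  by rewrite nth_uniq // => /eqP.
- move=> i j /andP[hi hj]; rewrite /leftover_placement.
  have [k nk] := sizeL _ hi; case: ifP => h.
    have h' := turnL _ _ (mem _ _ h).
    exists i, (index (axis_turn (nth axO (L i) j)) (L i)).
    rewrite index_mem h' nth_index //; split=> //; rewrite /valid hi nk /=.
    by apply: leq_trans (leq_addr _ _); rewrite index_mem.
  have [j' q e] := quarter_placement_turn 3 i (j - size (L i)).
  exists i, (size (L i) + j'); split.
    rewrite /valid hi /=; move: hj q h; rewrite nk; move: (size (L i)) => z; lia.
  by rewrite ltnNge leq_addr /= addKn.
- move=> i j k l i' j' k' l' _ _ _ _ /part <- /part <-; exact.
- by move=> i j n b /free ->; do 2 eexists.
- move=> i j i' j' [n b] _ _ /free e1 /free /=; rewrite e1.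
  by case/orbit_inj.
- by move=> i j i' j' _ _ /axis h /axis h'; exact: sepL h h' erefl.
- by left=> i j i' j' _ _ /axis h /axis h'; exact: sepL h h' erefl.
Qed.

(** Here h exchanges parts 0 and 1. Their first vertices sit at A and B; afterwards two consecutive
    vertices take z and -z in part 0, iz and -iz in part 1. The edge from A to B covers O, so the
    leftover vertex of part 2 goes to N. *)
Definition swapped_placement (i j : nat) : position :=
  if j is m.+1 then
    if i < 2 then inl (orbit 3 0 (m %/ 2), (i == 1, odd m)) else quarter_placement 3 1 m
  else inr (if i is i'.+1 then if i' is 0 then axB else axN else axA).

Lemma swapped_core_placement a c : odd a -> c = 0 \/ c %% 4 = 1 ->
  core_placement [:: a; a; c] swapped_placement.
Proof.
move=> oa oc; set s := [:: a; a; c].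
have size3 i j : valid s i j -> i < 3 by case/andP.
pose sw i := if i is i'.+1 then if i' is 0 then 0 else i else 1.
have part i j i' j' : i < 3 -> i' < 3 ->
    swapped_placement i' j' = turn (swapped_placement i j) -> i' = sw i.
  case: i => [|[|[|//]]] _; case: i' => [|[|[|//]]] _; case: j => [|j]; case: j' => [|j'] //=;
  by case=> /orbit_inj[].
split; first split.
- move=> i j i' j' /size3 + /size3.
  case: i => [|[|[|//]]] _; case: i' => [|[|[|//]]] _; case: j => [|j]; case: j' => [|j'] //=;
  by case=> /orbit_inj[] // _ _ q o; split=> //; lia.
- move=> i j v; case: i v => [|[|[|i]]] v; last by move/size3: v.
  + exists 1, j; split; first by move: v; rewrite /valid.
    by case: j v => [|j].
  + case: j v => [|j] v; first by exists 0, 0.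
    (* The image of vertex j+1 of part 1 has the opposite sign, so it is the partner of [j] in the
       pair 2k, 2k+1, shifted by one for the axis vertex. It exists because [a] is odd. *)
    exists 0, (if odd j then j else j.+2); split.
      by move: v; rewrite /valid /=; case: ifP; lia.
    case: ifP => oj /=; last first.
      by rewrite /quarter_turn /=; congr (inl (orbit _ _ _, (_, _))); lia.
    case: j oj {v} => // j oj.
    by rewrite /quarter_turn /=; congr (inl (orbit _ _ _, (_, _))); lia.
  + case: j v => [|j] v; first by exists 2, 0.
    have [j' q e] := quarter_placement_turn 3 1 j.
    by exists 2, j'.+1; split=> //; move: v; rewrite /valid /=; lia.
- move=> i j k l i' j' k' l' /size3 h1 /size3 h2 /size3 h3 /size3 h4.
  move=> /(part _ _ _ _ h1 h3) -> /(part _ _ _ _ h2 h4) ->.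
  by case: i k h1 h2 {h3 h4} => [|[|[|//]]] [|[|[|//]]].
- move=> i [//|j] n b /=.
  by case: ifP => _ [<- _]; do 2 eexists.
- move=> i j i' j' [n b] /size3 + /size3.
  case: i => [|[|[|//]]] _; case: i' => [|[|[|//]]] _; case: j => [|j]; case: j' => [|j'] //= -[<- <-];
  by case=> /orbit_inj[].
- by move=> i [|j] i' j' /size3; case: i => [|[|[|//]]] //=; case: ifP.
- by right=> i [|j] /size3; case: i => [|[|[|//]]].
Qed.

Lemma core_placement_exists (G1empty : bool) (a b c : nat) : q_condition G1empty a b c ->
  exists P, core_placement [:: a; b; c] P /\ (G1empty \/ avoids_N [:: a; b; c] P).
Proof.
have avoid L : (forall i, axN \notin L i) ->
    avoids_N [:: a; b; c] (leftover_placement L).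
  move=> nN i j _; rewrite /leftover_placement; case: ifP => // h [e].
  by have := nN i; rewrite -e mem_nth.
have [l a4] : exists l, a = a %% 4 + 4 * l by exists (a %/ 4); lia.
have [m b4] : exists m, b = b %% 4 + 4 * m by exists (b %/ 4); lia.
case=> [[b0 c0]|[[oa [ab c0]]|[[oa [ab [c1 G1]]]|[[a2 [b1 c0]]|[a2 [b2 [c0 G1]]]]]]].
(* A single part may hold A, B and O together, since its vertices are not adjacent; this covers
   every residue of [a] modulo 4 without N. *)
- pose L i : seq axis_pos := if i is 0 then
    match a %% 4 with 0 => [::] | 1 => [:: axO] | 2 => [:: axA; axB] | _ => [:: axA; axB; axO] end
    else [::].
  exists (leftover_placement L); split; last first.
    by right; apply: avoid => -[|i] //=; case: (a %% 4) => [|[|[|]]].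
  apply: leftover_core_placement.
  + case=> [|[|[|//]]] _ /=; [|by exists 0; rewrite b0|by exists 0; rewrite c0].
    exists l; rewrite {1}a4; congr (_ + _); have : a %% 4 < 4 by rewrite ltn_mod.
    by case: (a %% 4) => [|[|[|[|]]]].
  + by move=> [|i]; rewrite /L //; case: (a %% 4) => [|[|[|r]]].
  + by move=> [|i] c'; rewrite /L //; case: (a %% 4) => [|[|[|r]]]; case: c' => [[] []].
  + by case=> [|i] [|i'] //= d d'; rewrite ?in_nil.
- exists swapped_placement; subst b c; split; first by apply: swapped_core_placement; [|left].
  by right=> -[|[|[|//]]] [|j].
- exists swapped_placement; subst b; split; first by apply: swapped_core_placement; [|right].
  by left.
(* The two leftover vertices of the part of size 2 mod 4 are exchanged by h, and the one of the
   other part is fixed. *)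
- pose L i : seq axis_pos := match i with 0 => [:: axA; axB] | 1 => [:: axO] | _ => [::] end.
  exists (leftover_placement L); split; last by right; apply: avoid => -[|[|i]].
  apply: leftover_core_placement.
  + by case=> [|[|[|//]]] _ /=; [exists l; lia|exists m; lia|exists 0; lia].
  + by case=> [|[|]].
  + by case=> [|[|]] // [[] []].
  + by case=> [|[|i]] [|[|i']] // [[] []] [[] []].
(* All four axis positions are filled; using N is possible because $G_1$ is empty here. *)
- pose L i : seq axis_pos := match i with 0 => [:: axA; axB] | 1 => [:: axO; axN] | _ => [::] end.
  exists (leftover_placement L); split; last by left.
  apply: leftover_core_placement.
  + by case=> [|[|[|//]]] _ /=; [exists l; lia|exists m; lia|exists 0; lia].
  + by case=> [|[|]].
  + by case=> [|[|]] // [[] []].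
  + by case=> [|[|i]] [|[|i']] // [[] []] [[] []].
Qed.

Lemma core_no_antipodal_edge s P : core_placement s P -> no_antipodal_edge (@cmp_placement s P).
Proof.
move=> cP u v a uv eu ev; move: uv => /= /eqP; apply; apply/val_inj.
exact: cp_no_antipodal cP _ _ _ _ _ (valid_tag u) (valid_tag v) eu ev.
Qed.

Lemma core_axis_compatible s P : core_placement s P -> axis_compatible (@cmp_placement s P).
Proof.
move=> cP; split.
  move=> u v uv eu ev; move: uv => /= /eqP; apply; apply/val_inj.
  exact: cp_ON cP _ _ _ _ (valid_tag u) (valid_tag v) eu ev.
case: (cp_ABO cP) => [AB|nO]; [left|right].
  move=> u v uv eu ev; move: uv => /= /eqP; apply; apply/val_inj.
  exact: AB _ _ _ _ (valid_tag u) (valid_tag v) eu ev.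
by move=> u; exact/nO/valid_tag.
Qed.

Theorem theorem1 (R : realType) (s1 s2 s3 : seq nat) (q1 q2 q3 : nat) :
  all (fun m => ~~ odd m) s2 ->
  all (fun m => 4 %| m) s3 ->
  (exists a b c : nat, perm_eq [:: a; b; c] [:: q1; q2; q3] /\
     q_condition (#|vert (cmp s1)| == 0) a b c) ->
  achirally_embeddable R
    (gjoin (njoin 4 (cmp s1))
       (gjoin (njoin 2 (cmp s2)) (gjoin (cmp s3) (cmp [:: q1; q2; q3])))).
Proof.
move=> s2P s3P [a [b [c [perm_abc qc]]]].
have [P [cP nN]] : exists P, core_placement [:: q1; q2; q3] P /\
    (#|vert (cmp s1)| == 0 \/ avoids_N [:: q1; q2; q3] P).
  have [P0 [cP0 nN0]] := core_placement_exists qc.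
  rewrite perm_sym in perm_abc; have [P [cP nN]] := core_placement_perm perm_abc cP0.
  by exists P; split=> //; case: nN0 => [|/nN]; [left|right].
pose f1 := @quadruple_placement (cmp s1).
pose f2 := @double_placement s2.
pose f3 := @cmp_placement s3 (quarter_placement 2).
pose f4 := @cmp_placement [:: q1; q2; q3] P.
have block4 u t i j k : f4 u = inl (orbit t i j, k) -> t = 3.
  by move/(cp_block cP) => [i' [j' /orbit_inj[]]].
have d34 u v : f3 u <> f4 v by move/esym/block4.
have sp34 := join_symmetric_placement (four_dvd_symmetric_placement s3P)
  (cmp_symmetric_placement (cp_mp cP)) d34.
have d2 u v : f2 u <> join_placement f3 f4 v.
  by case: u v => [u|[u|[]]] [v|v] /=; try (by case=> /orbit_inj[]); move/esym/block4.
have sp2 := join_symmetric_placement (even_symmetric_placement s2P) sp34 d2.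
have d1 u v : f1 u <> join_placement f2 (join_placement f3 f4) v.
  by case: u v => [u|[u|[u|[u|[]]]]] [[v|[v|[]]]|[v|v]] /=;
    try (by case=> /orbit_inj[]); move/esym/block4.
have sp1 := join_symmetric_placement (@quadruple_symmetric_placement (cmp s1)) sp2 d1.
have off1 : off_axis f1 by case=> [u|[u|[u|[u|[]]]]].
have off2 : off_axis f2 by case=> [u|[u|[]]].
have ac : axis_compatible (join_placement f1 (join_placement f2 (join_placement f3 f4))).
  do 3 (apply: join_axis_compatible => //); exact: core_axis_compatible.
have na := join_no_antipodal_edge (even_symmetric_placement s2P) sp34 d2
  (@even_no_antipodal_edge s2) (join_no_antipodal_edge (four_dvd_symmetric_placement s3P)
    (cmp_symmetric_placement (cp_mp cP)) d34 (@four_dvd_no_antipodal_edge s3)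
    (core_no_antipodal_edge cP)).
apply: layout_achiral; apply: placement_layout sp1 ac _.
- by do ?[apply: loopfree_join | apply: loopfree_njoin | apply: loopfree_cmp].
- by do ?[apply: undirected_join | apply: undirected_njoin | apply: undirected_cmp].
(* Either $4G_1$ has no vertices and the other factors have no antipodal edges, or N is
   unoccupied. *)
case: nN => [/eqP/card0_eq s1_empty|nN]; [left|right].
  apply: join_no_antipodal_edge => //; first exact: quadruple_symmetric_placement.
  by case=> [u|[u|[u|[u|[]]]]]; have := s1_empty u; rewrite inE.
case=> [u|[u|[u|u]]] /=; [exact: off1|exact: off2|by []|].
exact/nN/valid_tag.
Qed.
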